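(* Let $M\subset\mathbb{R}^n$ be open, let $V_i=(Y_i,C_i,\tau_i)\in V_m(M)$, $i=1,\dots,k$, be such that $K=\mathrm{span}\{V_1,\dots,V_k\}$ is a Lie subalgebra of $V_m(M)$, and let $x_0\in M$ be such that $Y_1(x_0),\dots,Y_k(x_0)$ are linearly independent. Then there exist an open neighborhood $U$ of $x_0$ and a stochastic transformation $T\in S_m(U)$ of the form $T=(\mathrm{id}_U,B,\eta)$ such that $T_*(V_1),\dots,T_*(V_k)$ are strong infinitesimal stochastic transformations in $V_m(U)$. Furthermore the smooth functions $B,\eta$ are solutions to the equations $$Y_i(B)=-B\cdot C_i,\qquad Y_i(\eta)=-\tau_i\,\eta,\qquad i=1,\dots,k.$$
   Context: $SO(m)$ denotes the special orthogonal group, $so(m)$ the antisymmetric $m\times m$ matrices, $\mathbb{R}_+$ the positive reals. $Y(F)=Y^j\partial_jF$ is applied entrywise to matrix-valued functions. Spans are over $\mathbb{R}$. $S_m(U)$ is the set of stochastic transformations of the open set $U$: triads $T=(\Phi,B,\eta)$ with $\Phi:U\to U$ a diffeomorphism, $B:U\to SO(m)$ and $\eta:U\to\mathbb{R}_+$ smooth. $V_m(M)$ is the set of infinitesimal stochastic transformations on $M$: triads $V=(Y,C,\tau)$ with $Y$ a smooth vector field on $M$, $C:M\to so(m)$ and $\tau:M\to\mathbb{R}$ smooth. It is a Lie algebra with bracket $$[V_1,V_2]=\big([Y_1,Y_2],\,Y_1(C_2)-Y_2(C_1)-\{C_1,C_2\},\,Y_1(\tau_2)-Y_2(\tau_1)\big),$$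 where $\{\cdot,\cdot\}$ is the matrix commutator. $V$ is called strong if it is of the form $(Y,0,0)$. The push-forward of $V=(Y,C,\tau)$ by $T=(\Phi,B,\eta)$ is $$T_*(V)=\big((D(\Phi)\cdot Y)\circ\Phi^{-1},\,(B\cdot C\cdot B^{-1}+Y(B)\cdot B^{-1})\circ\Phi^{-1},\,(\tau+Y(\eta)\eta^{-1})\circ\Phi^{-1}\big),$$ with $D(\Phi)$ the Jacobian matrix of $\Phi$. Elements of $V_m(M)$ are restricted to $U$ when pushed forward by $T\in S_m(U)$. *)

(* Defs.v *)
From HB Require Import structures.
From mathcomp Require Export all_boot all_order all_algebra.
From mathcomp Require Export all_classical all_reals all_analysis.

Set Implicit Arguments.
Unset Strict Implicit.
Unset Printing Implicit Defensive.

Import Order.TTheory GRing.Theory Num.Theory.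
Import numFieldNormedType.Exports.

Local Open Scope classical_set_scope.
Local Open Scope ring_scope.

(* Functions on an open set U are represented by total functions on 'rV[R]_n
   of which only the values on U matter: two of them are identified when they
   agree on U. *)

Section Smoothness.
Context {R : realType} {n : nat}.
Implicit Types (U : set 'rV[R]_n).

Definition partial (j : 'I_n) (f : 'rV[R]_n -> R) : 'rV[R]_n -> R :=
  fun x => 'D_(delta_mx 0 j) f x.

Fixpoint Cr (r : nat) U (f : 'rV[R]_n -> R) : Prop :=
  (forall x, U x -> {for x, continuous f}) /\
  (if r is r'.+1 then
     forall j : 'I_n,
       (forall x, U x -> derivable f x (delta_mx 0 j)) /\
       Cr r' U (partial j f)
   else True).

Definition smooth U (f : 'rV[R]_n -> R) : Prop := forall r, Cr r U f.

Definition smoothmx U p q (F : 'rV[R]_n -> 'M[R]_(p, q)) : Prop :=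
  forall a b, smooth U (fun x => F x a b).

Definition vf_app (Y : 'rV[R]_n -> 'rV[R]_n) (f : 'rV[R]_n -> R) :
    'rV[R]_n -> R :=
  fun x => \sum_(j < n) Y x 0 j * partial j f x.

Definition vf_appmx (Y : 'rV[R]_n -> 'rV[R]_n) p q
    (F : 'rV[R]_n -> 'M[R]_(p, q)) : 'rV[R]_n -> 'M[R]_(p, q) :=
  fun x => \matrix_(a < p, b < q) vf_app Y (fun y => F y a b) x.

(* The j-th component of [Y1, Y2] is Y1(Y2^j) - Y2(Y1^j). *)
Definition vf_bracket (Y1 Y2 : 'rV[R]_n -> 'rV[R]_n) : 'rV[R]_n -> 'rV[R]_n :=
  fun x => vf_appmx Y1 Y2 x - vf_appmx Y2 Y1 x.

Definition diffeomorphism U (Phi : 'rV[R]_n -> 'rV[R]_n) : Prop :=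
  [/\ set_bij U U Phi, smoothmx U Phi & smoothmx U (pinv U Phi)].

End Smoothness.

Definition special_orthogonal (R : realType) m (B : 'M[R]_m) : Prop :=
  B *m B^T = 1%:M /\ \det B = 1.

Definition skew_symmetric (R : realType) m (C : 'M[R]_m) : Prop :=
  C^T = - C.

(* Triads (Phi, B, eta) and (Y, C, tau).  The latter, as a product of function
   spaces, inherits from the library its pointwise structure of R-module. *)
Definition stoch_triad (R : realType) (n m : nat) : Type :=
  (('rV[R]_n -> 'rV[R]_n) * ('rV[R]_n -> 'M[R]_m) * ('rV[R]_n -> R))%type.
Definition inf_triad (R : realType) (n m : nat) : lmodType R :=
  (('rV[R]_n -> 'rV[R]_n) * ('rV[R]_n -> 'M[R]_m) * ('rV[R]_n -> R))%type.

Section StochasticTransformations.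
Context {R : realType} {n m : nat}.
Implicit Types (M U : set 'rV[R]_n) (T : stoch_triad R n m)
  (V W : inf_triad R n m).

Definition stoch_transf U : set (stoch_triad R n m) :=
  fun T => let: (Phi, B, eta) := T in
  [/\ diffeomorphism U Phi,
      smoothmx U B /\ (forall x, U x -> special_orthogonal (B x)) &
      smooth U eta /\ (forall x, U x -> 0 < eta x)].

Definition inf_stoch_transf M : set (inf_triad R n m) :=
  fun V => let: (Y, C, tau) := V in
  [/\ smoothmx M Y,
      smoothmx M C /\ (forall x, M x -> skew_symmetric (C x)) &
      smooth M tau].

Definition strong M V : Prop :=
  let: (_, C, tau) := V in forall x, M x -> C x = 0 /\ tau x = 0.

Definition eq_on M V W : Prop :=
  let: (Y1, C1, tau1) := V in
  let: (Y2, C2, tau2) := W in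
  forall x, M x -> [/\ Y1 x = Y2 x, C1 x = C2 x & tau1 x = tau2 x].

Definition bracket V W : inf_triad R n m :=
  let: (Y1, C1, tau1) := V in
  let: (Y2, C2, tau2) := W in
  (vf_bracket Y1 Y2,
   (fun x => vf_appmx Y1 C2 x - vf_appmx Y2 C1 x
             - (C1 x *m C2 x - C2 x *m C1 x)),
   (fun x => vf_app Y1 tau2 x - vf_app Y2 tau1 x)).

Definition span_on M k (V : 'I_k -> inf_triad R n m) :
    set (inf_triad R n m) :=
  fun W => exists c : 'I_k -> R, eq_on M W (\sum_(i < k) c i *: V i).

Definition lie_subalgebra M (K : set (inf_triad R n m)) : Prop :=
  [/\ K `<=` inf_stoch_transf M,
      K 0,
      (forall (a : R) V W, K V -> K W -> K (a *: V + W)) &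
      (forall V W, K V -> K W -> K (bracket V W))].

(* For T in stoch_transf U, pinv U Phi is the inverse of Phi on U.  Vectors
   are rows, so D(Phi).Y reads Y *m 'J Phi. *)
Definition pushforward U T V : inf_triad R n m :=
  let: (Phi, B, eta) := T in
  let: (Y, C, tau) := V in
  ((fun x => Y x *m 'J Phi x) \o pinv U Phi,
   (fun x => B x *m C x *m invmx (B x) + vf_appmx Y B x *m invmx (B x))
     \o pinv U Phi,
   (fun x => tau x + vf_app Y eta x * (eta x)^-1) \o pinv U Phi).

End StochasticTransformations.

(* Main.v *)
From HB Require Import structures.
From mathcomp Require Import lra ring.
Require Import Defs.
Set Implicit Arguments.
Unset Strict Implicit.
Unset Printing Implicit Defensive.
Import Order.TTheory GRing.Theory Num.Theory.
Import numFieldNormedType.Exports.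
Local Open Scope classical_set_scope.
Local Open Scope ring_scope.

(* At x0 some k coordinates f make the matrix (Y_i^(f j)) invertible, so near
   x0 there is a frame X_i = sum_a g_ia Y_a with X_i(x^(f j)) = delta_ij.  The
   brackets [X_i, X_j] are combinations of the Y_a killing these coordinates,
   hence vanish, and the same coefficients show that A_i = sum_a g_ia C_a is
   flat: X_i(A_j) - X_j(A_i) = [A_i, A_j].  From a point x follow for time 1
   the flow gamma of sum_j s_j X_j with s = x0^f - x^f, which ends on the slice
   through x0 transverse to the X_i, and solve W' = (sum_j s_j A_j)(gamma) W
   along it from W(0) = 1.  Then B(x) = W(1) works: in the direction X_i the
   variation of (gamma, s, W) is
     ((1-t) X_i(gamma), -e_i, (1-t) A_i(gamma) W - W A_i(x)),
   because, by commutation and flatness, this solves the linearised equation;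
   at t = 1 its last component is -B A_i.  As the vector field on the
   (x, s, W)-space vanishes at (x0, 0, 1), its flow exists up to time 1 nearby,
   and the smoothness of B is smooth dependence on initial conditions.  The
   scalar eta is the case of 1 x 1 matrices C = tau. *)

(** * Differentiability from continuous partial derivatives *)

(** The equations constrain [B] only along the directions [Y_i]. Hence no chart adapted to the [X_i]
    is built: an explicit [B] is differentiated in the directions [X_i], and transversally only its
    smoothness matters. In the variation, the weight [1 - t] says that displacing [x] along [X_i]
    moves the curve but not its end on the slice; the term [- W A_i(x)] says that the displaced
    curve has lost an initial piece, whose transport has to be undone. Making [s] a state of zero
    velocity turns a family of equations into one autonomous equation with a rest point; Gronwall's
    inequality then confines nearby solutions up to time 1, and no maximal solution is ever
    considered. Autonomy also serves smoothness: a field together with its linearisation is again an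
    autonomous field, in twice the dimension, so regularity is gained one order at a time.
    Skew-symmetry of [C] yields only orthogonality of [B], hence determinant 1 or -1; the sign comes
    from [B(x0) = 1] and continuity. *)

Section RowVectors.
Context {R : realType} {n : nat}.
Implicit Types (x v : 'rV[R]_n).

Lemma normr_coord x i : `|x 0 i| <= `|x|.
Proof.
rewrite [leRHS]/Num.Def.normr/= mx_normrE.
exact: (le_bigmax _ (fun ij => `|x ij.1 ij.2|) (0, i)).
Qed.

Lemma rV_norm_le x (e : R) : 0 <= e -> (forall i, `|x 0 i| <= e) -> `|x| <= e.
Proof.
move=> e0 xe; rewrite [leLHS]/Num.Def.normr/= mx_normrE.
by apply: bigmax_le => // -[i j] _ /=; rewrite ord1.
Qed.

Lemma sum_coord_le x (c : 'I_n -> R) (K : R) :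
  (forall j, `|c j| <= K) -> `|\sum_j x 0 j * c j| <= n%:R * K * `|x|.
Proof.
move=> cK; apply: le_trans (ler_norm_sum _ _ _) _.
apply: (@le_trans _ _ (\sum_(j < n) K * `|x|)).
  apply: ler_sum => j _; rewrite normrM mulrC.
  by apply: ler_pM => //; exact: normr_coord.
by rewrite sumr_const card_ord -mulrA mulr_natl.
Qed.

End RowVectors.

Section LineDerivative.
Context {R : realType} {V : normedModType R}.

Lemma is_derive_line (f : V -> R) (a v : V) (s : R) :
  derivable f (s *: v + a) v ->
  is_derive s 1 (fun r : R => f (r *: v + a)) ('D_v f (s *: v + a)).
Proof.
have E : (fun h : R => h^-1 *: (f ((h *: 1 + s) *: v + a) - f (s *: v + a)))
   = (fun h : R => h^-1 *: (f (h *: v + (s *: v + a)) - f (s *: v + a))).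
  by apply/funext => h; rewrite addrA -scalerDl /GRing.scale /= mulr1.
by move=> df; split; rewrite /derivable /derive E.
Qed.

(** Only [|s| <= |t|] is recorded about the intermediate point, so that one statement serves both
    signs of [t]; it will be applied to coordinates of arbitrary sign. *)
Lemma MVT_line (f : V -> R) (a v : V) (t : R) :
  (forall s : R, `|s| <= `|t| -> derivable f (s *: v + a) v) ->
  exists2 s, `|s| <= `|t| & f (t *: v + a) - f a = t * 'D_v f (s *: v + a).
Proof.
move=> df; pose g (r : R) : R := f (r *: v + a).
have dg (s : R) : `|s| <= `|t| -> is_derive s (1:R) g ('D_v f (s *: v + a)).
  by move=> st; exact/is_derive_line/df.
have cg (b c : R) : (forall s : R, s \in `[b, c] -> `|s| <= `|t|) ->
    {within `[b, c], continuous g}.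
  move=> H; apply: derivable_within_continuous => s /H st.
  by have [] := dg s st.
have [t0|/ltW t0] := leP 0 t.
  have H (s : R) : s \in `[0, t] -> `|s| <= `|t|.
    by rewrite in_itv /= => /andP[s0 st]; rewrite !ger0_norm.
  have [||s sI] := @MVT_segment R g (fun s => 'D_v f (s *: v + a)) 0 t t0.
  - by move=> s sI; apply: dg; apply: H; exact: subset_itv_oo_cc.
  - exact: cg.
  - rewrite /g scale0r add0r subr0 mulrC => ->.
    by exists s => //; exact: H.
have H (s : R) : s \in `[t, 0] -> `|s| <= `|t|.
  by rewrite in_itv /= => /andP[st s0]; rewrite !ler0_norm// lerN2.
have [||s sI] := @MVT_segment R g (fun s => 'D_v f (s *: v + a)) t 0 t0.
- by move=> s sI; apply: dg; apply: H; exact: subset_itv_oo_cc.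
- exact: cg.
- rewrite /g scale0r add0r sub0r mulrN => E.
  by exists s; [exact: H|rewrite -opprB E mulrC opprK].
Qed.

End LineDerivative.

Lemma linear_approx_differentiable (R : realType) (V W : normedModType R)
    (f : V -> W) (L : {linear V -> W}) (x : V) : continuous L ->
  (forall e : R, 0 < e ->
    \forall h \near 0, `|f (h + x) - (f x + L h)| <= e * `|h|) ->
  differentiable f x /\ 'd f x =1 L.
Proof.
move=> cL fL.
have dE : f \o shift x = cst (f x) + L +o_ 0 id.
  by apply/eqaddoP => e e0; exact: fL.
have dL := diff_unique cL dE.
split; last by move=> v; rewrite dL.
by apply/diff_locallyP; rewrite dL.
Qed.

Section Differentiable.
Context {R : realType} {n : nat}.
Implicit Types (U : set 'rV[R]_n) (f : 'rV[R]_n -> R).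

(** These truncations lead from 0 to [h] in [n] axis-parallel steps, each of which involves a single
    partial derivative. *)
Let head_row (k : nat) (h : 'rV[R]_n) : 'rV[R]_n :=
  \row_j (if (j < k)%N then h 0 j else 0).

Let head_rowS (k : 'I_n) h :
  head_row k.+1 h = h 0 k *: delta_mx 0 k + head_row k h.
Proof.
apply/rowP => j; rewrite !mxE eqxx /=.
have [->|jk] := eqVneq j k; first by rewrite ltnSn ltnn mulr1 addr0.
by rewrite mulr0 add0r ltnS leq_eqVlt (inj_eq val_inj) (negbTE jk).
Qed.

(** Bridge from [Cr], which speaks of partial derivatives only, to the Frechet derivative on which
    the chain rule rests. The increment of [f] telescopes along the truncations of [h], and on each
    step the mean value theorem produces a partial derivative at a point near [x]. *)
Lemma partials_differentiable U f x : open U -> U x ->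
  (forall j y, U y -> derivable f y (delta_mx 0 j)) ->
  (forall j, {for x, continuous (partial j f)}) -> differentiable f x.
Proof.
move=> oU Ux df cf.
pose L0 (v : 'rV[R]_n) : R := \sum_j v 0 j * partial j f x.
have linL : linear L0.
  move=> a u v; rewrite /L0 scaler_sumr -big_split /=.
  by apply: eq_bigr => j _; rewrite !mxE mulrDl -mulrA.
pose L : {linear 'rV[R]_n -> R} :=
  HB.pack L0 (GRing.isLinear.Build _ _ _ _ L0 linL).
have LE v : L v = \sum_j v 0 j * partial j f x by [].
have cL : continuous (L : 'rV[R]_n -> R).
  have -> : (L : 'rV[R]_n -> R) =
      (fun v => \sum_j partial j f x *: (v 0 j : R)).
    by apply/funext => v; rewrite LE; apply: eq_bigr => j _; rewrite mulrC.
  move=> v; apply: differentiable_continuous.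
  have -> : (fun v : 'rV[R]_n => \sum_j partial j f x *: (v 0 j : R)) =
     \sum_j (fun v : 'rV[R]_n => partial j f x *: (v 0 j : R)).
    by apply/funext => u; rewrite fct_sumE.
  apply: differentiable_sum => j.
  by apply: differentiableZ; exact: differentiable_coord.
apply: (@proj1 _ ('d f x =1 L)).
apply: linear_approx_differentiable => // _ /posnumP[e].
(* Each of the [n] steps contributes at most [|h|] times this tolerance, so that they add up to at
   most [e * |h|]; the divisor [n.+1] also covers [n = 0]. *)
have [d d0 dP] : exists2 d : R, 0 < d & forall y, `|y| < d -> U (y + x) /\
    forall j, `|partial j f (y + x) - partial j f x| <= e%:num / n.+1%:R.
  have e0 : 0 < e%:num / n.+1%:R :> R by [].
  have nU : nbhs x U by exact: open_nbhs_nbhs.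
  have np : \forall y \near x,
      forall j, `|partial j f y - partial j f x| <= e%:num / n.+1%:R.
    apply: (@filter_forall _ 'I_n (fun j y =>
      `|partial j f y - partial j f x| <= e%:num / n.+1%:R) (nbhs x) _) => j.
    have /cvgrPdist_le/(_ _ e0) := cf j.
    by apply: filterS => y; rewrite distrC.
  have [d /= d0 dP] := (@nbhs_normP R _ x _).1 (filterI nU np); exists d => // y yd.
  by apply: dP; rewrite /= opprD addrCA subrr addr0 normrN.
near=> h; have hd : `|h| < d.
  by near: h; exact: (@nbhs0_lt R 'rV[R]_n d d0).
have hn : head_row n h = h.
  by apply/rowP => j; rewrite mxE ltn_ord.
have h0 : head_row 0 h = 0 by apply/rowP => j; rewrite !mxE.
have -> : f (h + x) - (f x + L h) = \sum_(k < n)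
   (f (head_row k.+1 h + x) - f (head_row k h + x) - h 0 k * partial k f x).
  rewrite sumrB -LE opprD addrA; congr (_ - _).
  have := telescope_sumr (fun k => f (head_row k h + x)) (leq0n n).
  by rewrite big_mkord hn h0 add0r => ->.
apply: le_trans (ler_norm_sum _ _ _) _.
apply: (@le_trans _ _ (\sum_(k < n) `|h| * (e%:num / n.+1%:R))); last first.
  rewrite sumr_const card_ord -mulrnAr [leRHS]mulrC; apply: ler_wpM2l => //.
  by rewrite -mulrnAr ler_piMr// -mulr_natl ler_pdivrMr// mul1r ler_nat.
apply: ler_sum => k _; rewrite head_rowS -(addrA (_ *: _)).
(* In the sup norm, dropping coordinates of [h] or shrinking one of them does not increase the norm,
   so all intermediate points stay in the ball of radius [d]. *)
have sub (s : R) : `|s| <= `|h 0 k| ->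
    `|s *: delta_mx 0 k + head_row k h| < d.
  move=> sh; apply: le_lt_trans hd; apply: rV_norm_le => // j.
  rewrite !mxE eqxx /=; have [->|jk] := eqVneq j k.
    rewrite ltnn mulr1 addr0; apply: le_trans sh _; exact: normr_coord.
  rewrite mulr0 add0r; case: ifP => _; last by rewrite normr0.
  exact: normr_coord.
have [|s sh ->] := @MVT_line _ _ f (head_row k h + x) (delta_mx 0 k) (h 0 k).
  move=> s sh; apply: df; rewrite addrA.
  by have [] := dP _ (sub _ sh).
rewrite -mulrBr normrM; apply: ler_pM => //; first exact: normr_coord.
rewrite addrA; have [_] := dP _ (sub _ sh); exact.
Unshelve. all: by end_near. Qed.

End Differentiable.

(** * Closure properties of C^r functions *)

Lemma rV_continuous (R : realType) (T : topologicalType) p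
    (G : T -> 'rV[R]_p) (x : T) :
  (forall i, {for x, continuous (fun y => G y 0 i)}) -> {for x, continuous G}.
Proof.
move=> cG; apply/cvgrPdist_le => e e0.
have nG : \forall y \near x, forall i, `|G x 0 i - G y 0 i| <= e.
  apply: (@filter_forall _ 'I_p (fun i y => `|G x 0 i - G y 0 i| <= e)
    (nbhs x) _) => i.
  by have /cvgrPdist_le/(_ _ e0) := cG i.
apply: (@filterS _ (nbhs x) _ _ _ _ nG) => y Hy.
by apply: rV_norm_le => [|i]; [exact: ltW|rewrite !mxE; exact: Hy].
Qed.

Section DirectionalDerivative.
Context {R : realType} {n : nat}.
Implicit Types (f : 'rV[R]_n -> R).

Lemma derive_sum_partial f x v : differentiable f x ->
  'D_v f x = \sum_j v 0 j * partial j f x.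
Proof.
move=> df; rewrite deriveE// {1}(row_sum_delta v) linear_sum.
by apply: eq_bigr => j _; rewrite linearZ /partial deriveE.
Qed.

Lemma vf_appE (Y : 'rV[R]_n -> 'rV[R]_n) f x : differentiable f x ->
  vf_app Y f x = 'D_(Y x) f x.
Proof. by move=> df; rewrite derive_sum_partial. Qed.

Lemma rV_differentiable (V : normedModType R) p (G : V -> 'rV[R]_p) (x : V) :
  (forall i, differentiable (fun y => G y 0 i) x) -> differentiable G x.
Proof.
move=> dG.
have -> : G = \sum_i (fun y => G y 0 i *: (delta_mx 0 i : 'rV[R]_p)).
  by apply/funext => y; rewrite fct_sumE -row_sum_delta.
by apply: differentiable_sum => i; exact: differentiableZl.
Qed.

Lemma derive_rV (V : normedModType R) p (G : V -> 'rV[R]_p) (x v : V) i :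
  (forall i, differentiable (fun y => G y 0 i) x) ->
  'd G x v 0 i = 'D_v (fun y => G y 0 i) x.
Proof.
move=> dG; have dG' := rV_differentiable dG.
by rewrite -deriveE// derive_mx ?mxE//; exact: diff_derivable.
Qed.

Lemma differentiable_comp_rV (V : normedModType R) f (G : V -> 'rV[R]_n) x :
  differentiable f (G x) -> (forall i, differentiable (fun y => G y 0 i) x) ->
  differentiable (f \o G) x.
Proof. by move=> df /rV_differentiable dG; exact: differentiable_comp. Qed.

Lemma derive_comp_rV (V : normedModType R) f (G : V -> 'rV[R]_n) x v :
  differentiable f (G x) -> (forall i, differentiable (fun y => G y 0 i) x) ->
  'D_v (f \o G) x = \sum_i 'D_v (fun y => G y 0 i) x * partial i f (G x).
Proof.
move=> df dG; have dG' := rV_differentiable dG.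
rewrite deriveE; last exact: differentiable_comp.
rewrite diff_comp//= -deriveE// derive_sum_partial//.
by apply: eq_bigr => i _; rewrite derive_rV.
Qed.

End DirectionalDerivative.

Lemma is_derive_coord (R : realType) n (y w : 'rV[R]_n) i :
  is_derive y w (fun z => z 0 i) (w 0 i).
Proof.
have dI : derivable (id : 'rV[R]_n -> 'rV[R]_n) y w by exact: derivable_id.
split; first by apply: diff_derivable; exact: differentiable_coord.
have := derive_mx dI.
have -> : 'D_w (id : 'rV[R]_n -> 'rV[R]_n) y = w by exact: derive_id.
by move=> /(congr1 (fun v : 'rV[R]_n => v 0 i)) /= ->; rewrite [RHS]mxE.
Qed.

Section CrTheory.
Context {R : realType}.

Section Generalities.
Context {n : nat}.
Implicit Types (U : set 'rV[R]_n) (f g : 'rV[R]_n -> R).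

Lemma Cr_continuous r U f x : Cr r U f -> U x -> {for x, continuous f}.
Proof. by case: r => [|r] [cf _]; exact: cf. Qed.

Lemma Cr_pred r U f : Cr r.+1 U f -> Cr r U f.
Proof.
elim: r f => [|r IH] f [cf df]; first by split.
by split=> // j; have [] := df j; split=> //; exact: IH.
Qed.

Lemma Cr_subset r U U' f : U' `<=` U -> Cr r U f -> Cr r U' f.
Proof.
move=> sU; elim: r f => [|r IH] f [cf df]; split.
- by move=> x /sU; exact: cf.
- by [].
- by move=> x /sU; exact: cf.
- move=> j; have [dj Cj] := df j; split; last exact: IH.
  by move=> x /sU; exact: dj.
Qed.

Lemma Cr_differentiable r U f x :
  open U -> Cr r.+1 U f -> U x -> differentiable f x.
Proof.
move=> oU [cf df] Ux; apply: (partials_differentiable oU) => //.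
  by move=> j; have [] := df j.
by move=> j; have [_ /Cr_continuous] := df j; exact.
Qed.

Lemma CrS r U f : (forall x, U x -> differentiable f x) ->
  (forall j, Cr r U (partial j f)) -> Cr r.+1 U f.
Proof.
move=> df Cf; split=> [x Ux|j]; first exact/differentiable_continuous/df.
by split=> // x Ux; exact/diff_derivable/df.
Qed.

Let continuous_eq_on U f g x : open U -> (forall y, U y -> f y = g y) ->
  U x -> {for x, continuous f} -> {for x, continuous g}.
Proof.
move=> oU fg Ux cf; rewrite /prop_for /continuous_at -(fg _ Ux).
apply: cvg_trans cf; apply: (@near_eq_cvg _ _ (nbhs x)).
by apply: (@filterS _ (nbhs x) _ U _ fg); exact: open_nbhs_nbhs.
Qed.

Lemma Cr_eq_on r U f g : open U -> (forall x, U x -> f x = g x) ->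
  Cr r U f -> Cr r U g.
Proof.
move=> oU; elim: r f g => [|r IH] f g fg [cf df].
  by split=> // x Ux; exact: (continuous_eq_on oU fg Ux (cf x Ux)).
have nfg x : U x -> {near x, f =1 g}.
  by move=> Ux; apply: (@filterS _ (nbhs x) _ U _ fg); exact: open_nbhs_nbhs.
split=> [x Ux|j]; first exact: (continuous_eq_on oU fg Ux (cf x Ux)).
have [dj Cj] := df j; split.
  by move=> x Ux; apply: near_eq_derivable (nfg _ Ux) (dj _ Ux).
apply: IH Cj => x Ux; apply: near_eq_derive; exact: nfg.
Qed.

Lemma Cr_cst r U (c : R) : Cr r U (fun=> c).
Proof.
elim: r c => [|r IH] c; first by split=> // x _; exact: cst_continuous.
apply: CrS => [x _|j]; first exact: differentiable_cst.
have -> : partial j (fun _ : 'rV[R]_n => c) = fun=> 0.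
  by apply/funext => x; exact: derive_cst.
exact: IH.
Qed.

Lemma Cr_coord r U i : Cr r U (fun x => x 0 i).
Proof.
case: r => [|r]; first by split=> // x _; exact: coord_continuous.
apply: CrS => [x _|j]; first exact: differentiable_coord.
have -> : partial j (fun x : 'rV[R]_n => x 0 i) =
    fun=> (delta_mx 0 j : 'rV[R]_n) 0 i.
  apply/funext => x; rewrite /partial.
  by have [_ ->] := is_derive_coord x (delta_mx 0 j) i.
exact: Cr_cst.
Qed.

Lemma CrD r U f g : open U -> Cr r U f -> Cr r U g ->
  Cr r U (fun x => f x + g x).
Proof.
move=> oU; elim: r f g => [|r IH] f g Cf Cg.
  split=> // x Ux.
  exact: (continuousD (Cr_continuous Cf Ux) (Cr_continuous Cg Ux)).
apply: CrS => [x Ux|j].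
  exact: (differentiableD (Cr_differentiable oU Cf Ux)
    (Cr_differentiable oU Cg Ux)).
have [_ df] := Cf; have [_ dg] := Cg.
have [djf Cjf] := df j; have [djg Cjg] := dg j.
apply: Cr_eq_on (IH _ _ Cjf Cjg) => // x Ux.
by rewrite /partial -deriveD//; [exact: djf|exact: djg].
Qed.

Lemma CrM r U f g : open U -> Cr r U f -> Cr r U g ->
  Cr r U (fun x => f x * g x).
Proof.
move=> oU; elim: r f g => [|r IH] f g Cf Cg.
  split=> // x Ux.
  exact: (continuousM (Cr_continuous Cf Ux) (Cr_continuous Cg Ux)).
apply: CrS => [x Ux|j].
  exact: (differentiableM (Cr_differentiable oU Cf Ux)
    (Cr_differentiable oU Cg Ux)).
have [_ df] := Cf; have [_ dg] := Cg.
have [djf Cjf] := df j; have [djg Cjg] := dg j.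
apply: Cr_eq_on (CrD oU (IH _ _ (Cr_pred Cf) Cjg) (IH _ _ (Cr_pred Cg) Cjf)) => //.
move=> x Ux.
by rewrite /partial [RHS]deriveM//; [exact: djf|exact: djg].
Qed.

Lemma CrV r U f : open U -> (forall x, U x -> f x != 0) -> Cr r U f ->
  Cr r U (fun x => (f x)^-1).
Proof.
move=> oU f0; elim: r => [|r IH] Cf.
  by split=> // x Ux; exact: (continuousV (f0 _ Ux) (Cr_continuous Cf Ux)).
apply: CrS => [x Ux|j].
  exact: (differentiableV (Cr_differentiable oU Cf Ux) (f0 _ Ux)).
have [_ df] := Cf; have [djf Cjf] := df j.
have CV := IH (Cr_pred Cf).
apply: Cr_eq_on (CrM oU (Cr_cst _ _ (-1)) (CrM oU (CrM oU CV CV) Cjf)) => //.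
move=> x Ux; rewrite /partial [RHS](deriveV (f0 _ Ux) (djf _ Ux)) /GRing.scale /=.
by rewrite mulN1r mulNr expr2 invfM.
Qed.

Lemma Cr_sum r U (I : Type) (s : seq I) (P : pred I) (F : I -> 'rV[R]_n -> R) :
  open U -> (forall i, P i -> Cr r U (F i)) ->
  Cr r U (fun x => \sum_(i <- s | P i) F i x).
Proof.
move=> oU CF; elim: s => [|i s IH].
  by apply: Cr_eq_on (Cr_cst _ _ 0) => // x _; rewrite big_nil.
have [Pi|nPi] := boolP (P i).
  apply: Cr_eq_on (CrD oU (CF _ Pi) IH) => // x _.
  by rewrite big_cons Pi.
by apply: Cr_eq_on IH => // x _; rewrite big_cons (negbTE nPi).
Qed.

Lemma Cr_prod r U (I : Type) (s : seq I) (P : pred I) (F : I -> 'rV[R]_n -> R) :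
  open U -> (forall i, P i -> Cr r U (F i)) ->
  Cr r U (fun x => \prod_(i <- s | P i) F i x).
Proof.
move=> oU CF; elim: s => [|i s IH].
  by apply: Cr_eq_on (Cr_cst _ _ 1) => // x _; rewrite big_nil.
have [Pi|nPi] := boolP (P i).
  apply: Cr_eq_on (CrM oU (CF _ Pi) IH) => // x _.
  by rewrite big_cons Pi.
by apply: Cr_eq_on IH => // x _; rewrite big_cons (negbTE nPi).
Qed.

Lemma Cr_det r U m (A : 'rV[R]_n -> 'M[R]_m) : open U ->
  (forall a b, Cr r U (fun x => A x a b)) -> Cr r U (fun x => \det (A x)).
Proof.
move=> oU CA; apply: Cr_sum => // s _; apply: CrM => //; first exact: Cr_cst.
by apply: Cr_prod => // i _; exact: CA.
Qed.

(** By Cramer's rule the entries are cofactors divided by the determinant, and both are polynomial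
    in the entries of [A]. *)
Lemma Cr_invmx r U m (A : 'rV[R]_n -> 'M[R]_m) : open U ->
  (forall x, U x -> A x \in unitmx) ->
  (forall a b, Cr r U (fun x => A x a b)) ->
  forall a b, Cr r U (fun x => invmx (A x) a b).
Proof.
move=> oU uA CA a b.
suff C : Cr r U (fun x => (\det (A x))^-1 * \adj (A x) a b).
  by apply: Cr_eq_on C => // x Ux; rewrite /invmx uA// [RHS]mxE.
apply: CrM => //.
  apply: CrV => //; last exact: Cr_det.
  by move=> x /uA; rewrite unitmxE unitfE.
suff C : Cr r U (fun x => cofactor (A x) b a).
  by apply: Cr_eq_on C => // x _; rewrite mxE.
apply: CrM => //; first exact: Cr_cst.
apply: Cr_det => // i j; apply: Cr_eq_on (CA (lift b i) (lift a j)) => //.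
by move=> x _; rewrite !mxE.
Qed.

End Generalities.

(** The chain rule expresses a partial derivative of [f \o G] by products of a derivative of [G]
    with some [partial i f \o G], so the induction on [r] runs over all [f] with [G] fixed. *)
Lemma Cr_comp n p r (Omega : set 'rV[R]_p) (U : set 'rV[R]_n)
    (f : 'rV[R]_p -> R) (G : 'rV[R]_n -> 'rV[R]_p) :
  open Omega -> open U -> (forall x, U x -> Omega (G x)) ->
  Cr r Omega f -> (forall i, Cr r U (fun x => G x 0 i)) ->
  Cr r U (f \o G).
Proof.
move=> oO oU GU; elim: r f => [|r IH] f Cf CG.
  split=> // x Ux; apply: continuous_comp; last first.
    exact: (Cr_continuous Cf (GU _ Ux)).
  by apply: rV_continuous => i; exact: (Cr_continuous (CG i) Ux).
have dG x : U x -> forall i, differentiable (fun y => G y 0 i) x.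
  by move=> Ux i; exact: (Cr_differentiable oU (CG i) Ux).
have df x : U x -> differentiable f (G x).
  by move=> /GU; exact: (Cr_differentiable oO Cf).
apply: CrS => [x Ux|j].
  by apply: differentiable_comp_rV; [exact: df|exact: dG].
suff C : Cr r U (fun x => \sum_i partial j (fun y => G y 0 i) x
    * (partial i f \o G) x).
  apply: Cr_eq_on C => // x Ux.
  by rewrite /partial derive_comp_rV//; [exact: df|exact: dG].
apply: Cr_sum => // i _; apply: CrM => //.
  by have [_ /(_ j)[]] := CG i.
apply: IH => [|l]; last exact: Cr_pred.
by have [_ /(_ i)[]] := Cf.
Qed.

End CrTheory.

(** * Primitives and comparison of derivatives *)

Section Clamp.
Context {R : realType}.
Implicit Types (a b x y t : R).

(** For [a <= b], the retraction of the line onto the segment. It freezes solutions outside the time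
    interval and, applied to each coordinate, extends a vector field from a cube to the whole
    space. *)
Definition clamp a b x : R := Num.max a (Num.min x b).

Lemma clamp_itv a b x : a <= b -> a <= clamp a b x <= b.
Proof. by move=> ab; rewrite /clamp le_max lexx ge_max ab ge_min lexx orbT. Qed.

Lemma clamp_id a b x : a <= x <= b -> clamp a b x = x.
Proof. by move=> /andP[ax xb]; rewrite /clamp min_l// max_r. Qed.

Lemma clamp_lipschitz a b x y : `|clamp a b x - clamp a b y| <= `|x - y|.
Proof.
wlog xy : x y / x <= y.
  move=> H; have [/H//|/ltW/H] := leP x y.
  by rewrite distrC [leRHS]distrC.
rewrite [leRHS]distrC [leRHS]ger0_norm ?subr_ge0// ler_norml /clamp.
case: (leP x b) => ?; case: (leP y b) => ?.
- by case: (leP a x) => ?; case: (leP a y) => ?; lra.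
- by case: (leP a x) => ?; case: (leP a b) => ?; lra.
- by case: (leP a b) => ?; case: (leP a y) => ?; lra.
- by case: (leP a b) => ?; lra.
Qed.

Lemma lipschitz_continuous (V W : normedModType R) (G : V -> W) (L : R) :
  (forall x y : V, `|G x - G y| <= L * `|x - y|) -> continuous G.
Proof.
move=> GL x; apply/cvgrPdist_lt => e e0.
have L0 : 0 < `|L| + 1 :> R by rewrite ltr_wpDl.
have d0 : 0 < e / (`|L| + 1) by exact: divr_gt0.
apply/nbhs_normP; exists (e / (`|L| + 1)) => // y /= xy.
apply: le_lt_trans (GL x y) _.
apply: (@le_lt_trans _ _ ((`|L| + 1) * `|x - y|)).
  by rewrite ler_wpM2r// ler_wpDr// ler_norm.
by rewrite mulrC -ltr_pdivlMr.
Qed.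

Lemma clamp_continuous a b : continuous (clamp a b).
Proof.
by apply: (@lipschitz_continuous _ _ _ 1) => x y; rewrite mul1r clamp_lipschitz.
Qed.

End Clamp.

Notation clamp01 := (clamp 0 1).

Section OneVariable.
Context {R : realType}.
Implicit Types (g h H P dh dH : R -> R) (t : R).

Lemma clamp01_itv t : 0 <= clamp01 t <= 1.
Proof. exact: clamp_itv. Qed.

Lemma continuous_primitive g : continuous g -> exists P : R -> R,
  [/\ continuous P, P 0 = 0, (forall t, P t = P (clamp01 t)) &
      forall t, 0 < t < 1 -> is_derive t 1 P (g t)].
Proof.
move=> cg.
(* Integrating from -1 leaves room to the left of 0, so that the primitive is differentiable, hence
   continuous, at 0 as well; its value at 0 is subtracted afterwards. *)
pose F (x : R) : R := (\int[lebesgue_measure]_(t in `[(-1)%R, x]) g t)%R.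
have dF (x : R) : -1 < x -> is_derive x 1 F (g x).
  move=> x1.
  have ig : lebesgue_measure.-integrable `[(-1)%R, x + 1] (EFin \o g).
    apply: continuous_compact_integrable; first exact: segment_compact.
    exact: continuous_subspaceT.
  have xx : x < x + 1 by rewrite ltrDl.
  have [d1 d2] := continuous_FTC1_closed xx ig x1 (cg x).
  by split; [exact: d1|rewrite -derive1E; exact: d2].
pose P (t : R) : R := F (clamp01 t) - F 0.
have c0 : clamp01 (0 : R) = 0 by rewrite clamp_id// lexx ler01.
exists P; split.
- move=> x.
  have cF : {for x, continuous (F \o clamp01)}.
    apply: continuous_comp; first exact: clamp_continuous.
    have /andP[c1 _] := clamp01_itv x.
    have [dFx _] := dF _ (lt_le_trans (ltrN10 _) c1).
    exact/differentiable_continuous/derivable1_diffP.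
  exact: (continuousB cF (@cst_continuous _ _ (F 0) x)).
- by rewrite /P c0 subrr.
- by move=> t; rewrite /P (clamp_id (clamp01_itv t)).
- move=> t /andP[t0 t1].
  have dFt : is_derive t 1 F (g t) by apply: dF; apply: lt_trans t0; rewrite ltrN10.
  have dF0 : is_derive t 1 (F - cst (F 0)) (g t).
    by rewrite -[X in is_derive _ _ _ X]subr0; exact: is_deriveB.
  apply: near_eq_is_derive dF0.
  near=> s; rewrite /P clamp_id //; apply/andP; split; apply: ltW.
    by near: s; exact: lt_nbhsr.
  by near: s; exact: lt_nbhsl.
Unshelve. all: by end_near. Qed.

(** The difference [H - h] has a nonnegative derivative. Comparison with a majorant [H] of known
    derivative replaces estimates of integrals from here on. *)
Lemma derive_le h dh H dH : continuous h -> continuous H ->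
  (forall t, 0 < t < 1 -> is_derive t 1 h (dh t)) ->
  (forall t, 0 < t < 1 -> is_derive t 1 H (dH t)) ->
  (forall t, 0 < t < 1 -> dh t <= dH t) ->
  forall t, 0 <= t <= 1 -> h t - h 0 <= H t - H 0.
Proof.
move=> ch cH dh' dH' le t t01.
have dHh (s : R) : 0 < s < 1 -> is_derive s 1 (H - h) (dH s - dh s).
  by move=> s01; apply: is_deriveB; [exact: dH'|exact: dh'].
have := @ger0_derive1_le_cc R (H - h) 0 1.
move=> /(_ _ _ _ 0 t) K.
suff : (H - h) 0 <= (H - h) t.
  by rewrite !fctE /=; lra.
have [t0 t1] := andP t01.
apply: K => //.
- by move=> s; rewrite in_itv /= => /dHh[].
- move=> s; rewrite in_itv /= => s01; have := dHh _ s01 => -[_].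
  by rewrite derive1E => ->; rewrite subr_ge0; exact: le.
- by apply: continuous_subspaceT => s; apply: continuousB; [exact: cH|exact: ch].
- by rewrite in_itv /= lexx ler01.
Qed.

Lemma derive_abs_le h dh H dH : continuous h -> continuous H ->
  (forall t, 0 < t < 1 -> is_derive t 1 h (dh t)) ->
  (forall t, 0 < t < 1 -> is_derive t 1 H (dH t)) ->
  (forall t, 0 < t < 1 -> `|dh t| <= dH t) ->
  forall t, 0 <= t <= 1 -> `|h t - h 0| <= H t - H 0.
Proof.
move=> ch cH dh' dH' le t t01; rewrite ler_norml; apply/andP; split.
  rewrite lerNl opprB.
  have dN (s : R) : 0 < s < 1 -> is_derive s 1 (- h) (- dh s).
    by move=> s01; apply: is_deriveN; exact: dh'.
  have cN : continuous (- h) by move=> s; apply: continuousN; exact: ch.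
  have := derive_le cN cH dN dH' _ t01; rewrite !fctE opprK addrC; apply.
  by move=> s /le; rewrite ler_norml => /andP[+ _]; rewrite lerNl.
apply: derive_le t01 => // s /le; rewrite ler_norml => /andP[]//.
Qed.

End OneVariable.

(** * Gronwall's inequality and Picard's theorem *)

Lemma continuous_coord (R : realType) (T : topologicalType) (N : nat)
    (u : T -> 'rV[R]_N) (i : 'I_N) (t : T) :
  {for t, continuous u} -> {for t, continuous (fun s => u s 0 i)}.
Proof.
move=> cu.
exact: (@continuous_comp _ _ _ u (fun v : 'rV[R]_N => v 0 i) t cu
  (@coord_continuous _ _ _ 0 i (u t))).
Qed.

Lemma continuous_bigsum (R : realType) (T : topologicalType) (I : Type)
    (r : seq I) (F : I -> T -> R) (x : T) :
  (forall i, {for x, continuous (F i)}) ->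
  {for x, continuous (fun y => \sum_(i <- r) F i y)}.
Proof.
move=> cF; elim: r => [|i r IH].
  have -> : (fun y => \sum_(i <- [::]) F i y) = cst 0.
    by apply/funext => y; rewrite big_nil.
  exact: cst_continuous.
have -> : (fun y => \sum_(j <- i :: r) F j y) =
    F i \+ (fun y => \sum_(j <- r) F j y).
  by apply/funext => y; rewrite big_cons.
exact: (continuousD (cF i) IH).
Qed.

(* Uses the energy [\sum_i (g t 0 i)^2], as the sup norm is not differentiable. *)
Lemma gronwall (R : realType) (N : nat) (L : R) : 0 <= L ->
  exists2 C : R, 0 < C & forall (g dg : R -> 'rV[R]_N) (e : R), 0 <= e ->
    continuous g ->
    (forall t : R, 0 < t < 1 -> forall i,
      is_derive t 1 (fun s => g s 0 i) (dg t 0 i)) ->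
    (forall t : R, 0 < t < 1 -> `|dg t| <= L * `|g t| + e) ->
    forall t : R, 0 <= t <= 1 -> `|g t| <= C * (`|g 0| + e).
Proof.
(* Summing [2 |g| (L |g| + e) <= (2 L + 1) |g|^2 + e^2] over the [N] coordinates bounds the
   derivative of the energy. The term [N e^2] of [E] below absorbs the inhomogeneity, which leaves
   [E' <= c E]. *)
move=> L0; pose c : R := N%:R * (2 * L + 1) + 1.
(* The energy bounds the square of the norm with the constant [expR c * N]; since [1 <= C2], this
   constant is at most [C2 ^+ 2], so [C2] bounds the norm itself. *)
pose C2 : R := expR c * N%:R + 1.
have C2ge1 : 1 <= C2 by rewrite lerDr mulr_ge0// expR_ge0.
exists C2 => [|g dg e e0 cg ddg ledg t t01]; first exact: lt_le_trans C2ge1.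
pose E (s : R) : R := \sum_(i < N) (g s 0 i) ^+ 2 + N%:R * e ^+ 2.
have g_le (s : R) : `|g s| ^+ 2 * (N != 0)%:R <= \sum_(i < N) (g s 0 i) ^+ 2.
  have S0 : 0 <= \sum_(i < N) (g s 0 i) ^+ 2.
    by apply: sumr_ge0 => i _; exact: sqr_ge0.
  have [_|_] := eqVneq N 0; rewrite /= ?mulr0 ?mulr1//.
  rewrite -[leRHS]sqr_sqrtr// lerXn2r ?nnegrE ?sqrtr_ge0//.
  apply: rV_norm_le => [|i]; first exact: sqrtr_ge0.
  rewrite -sqrtr_sqr ler_sqrt// (bigD1 i)//= lerDl.
  by apply: sumr_ge0 => j _; exact: sqr_ge0.
have E_le : E 0 <= N%:R * (`|g 0| + e) ^+ 2.
  have : \sum_(i < N) (g 0 0 i) ^+ 2 <= N%:R * `|g 0| ^+ 2.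
    apply: (@le_trans _ _ (\sum_(i < N) `|g 0| ^+ 2)); last first.
      by rewrite sumr_const card_ord mulr_natl.
    apply: ler_sum => i _.
    rewrite -[leLHS]real_normK ?num_real// lerXn2r ?nnegrE//.
    exact: normr_coord.
  rewrite /E => H; apply: (le_trans (lerD H (lexx _))).
  rewrite -mulrDr ler_wpM2l// sqrrD.
  by have := mulr_ge0 (normr_ge0 (g 0)) e0; lra.
pose dE (s : R) : R := \sum_(i < N) (2 * g s 0 i * dg s 0 i).
have dE_is (s : R) : 0 < s < 1 -> is_derive s 1 E (dE s).
  move=> s01; rewrite /dE -[X in is_derive _ _ _ X]addr0.
  have -> : E = \sum_(i < N) (fun s => g s 0 i) ^+ 2 + cst (N%:R * e ^+ 2).
    by apply/funext => r; rewrite /E !fctE fct_sumE.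
  apply: is_deriveD; apply: is_derive_sum => i.
  have := is_deriveX 2 (ddg s s01 i).
  by rewrite expr1.
have dE_le (s : R) : 0 < s < 1 -> dE s <= c * E s.
  move=> s01.
  have N0 : 0 <= N%:R :> R by [].
  have : dE s <= \sum_(i < N) ((2 * L + 1) * `|g s| ^+ 2 + e ^+ 2).
    apply: ler_sum => i _.
    have gi := normr_coord (g s) i; have dgi := normr_coord (dg s) i.
    have dgl := ledg s s01.
    have gs0 := normr_ge0 (g s).
    apply: le_trans (ler_norm _) _; rewrite !normrM ger0_norm//.
    have K : `|g s 0 i| * `|dg s 0 i| <= `|g s| * (L * `|g s| + e).
      by apply: ler_pM => //; exact: le_trans dgl.
    have : 0 <= (`|g s| - e) ^+ 2 by exact: sqr_ge0.
    rewrite sqrrB; move: K; lra.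
  rewrite sumr_const card_ord => H; apply: (le_trans H).
  have := g_le s; rewrite /E /c -[_ *+ N]mulr_natl.
  have S0 : 0 <= \sum_(i < N) (g s 0 i) ^+ 2.
    by apply: sumr_ge0 => i _; exact: sqr_ge0.
  move: S0; set S := \sum_(i < N) _; move=> S0.
  have e20 := sqr_ge0 e.
  have [N_0 _|N1] := eqVneq N 0.
    have -> : N%:R = 0 :> R by rewrite N_0.
    by rewrite !mul0r add0r mul1r addr0.
  rewrite mulr1 => gS.
  have K1 : (2 * L + 1) * `|g s| ^+ 2 <= (2 * L + 1) * S.
    by rewrite ler_wpM2l//; lra.
  have K2 := ler_wpM2l N0 K1.
  have K3 : 0 <= N%:R * (2 * L + 1) * (N%:R * e ^+ 2).
    by rewrite !mulr_ge0//; lra.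
  by nra.
pose H (s : R) : R := E s * expR (- c * s).
have cE : continuous E.
  move=> s.
  have c1 : {for s, continuous (fun s => \sum_(i < N) (g s 0 i) ^+ 2)}.
    apply: continuous_bigsum => i.
    have ci := continuous_coord (i := i) (cg s); have := continuousM ci ci.
    suff -> : (fun r => g r 0 i ^+ 2) =
        (fun r => g r 0 i) \* (fun r => g r 0 i) by [].
    by apply/funext => r; rewrite expr2.
  exact: (continuousD c1 (@cst_continuous _ _ (N%:R * e ^+ 2) s)).
have dexp (s : R) : is_derive s 1 (fun r => expR (- c * r)) (- c * expR (- c * s)).
  have l : is_derive s 1 (fun r : R => - c * r) (- c).
    rewrite -[X in is_derive _ _ _ X]mulr1.
    exact: (is_deriveZ (- c) (is_derive_id s (1 : R))).
  have := @is_derive1_comp R expR (fun r => - c * r) s _ _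
    (is_derive_expR _) l.
  by rewrite mulrC.
have dH (s : R) : 0 < s < 1 -> is_derive s 1 H
    (E s * (- c * expR (- c * s)) + expR (- c * s) * dE s).
  by move=> s01; exact: (is_deriveM (dE_is s s01) (dexp s)).
have cH : continuous H.
  move=> s; have [dx _] := dexp s.
  have cx := differentiable_continuous ((derivable1_diffP _ _).1 dx).
  exact: (continuousM (cE s) cx).
have HH : H t - H 0 <= 0.
  rewrite -[leRHS](subrr (0 : R)).
  apply: (derive_le (H := cst 0) (dH := fun=> 0) cH (@cst_continuous _ _ _) dH) t01.
  move=> s /dE_le; have := expR_gt0 (- c * s).
  by move: (expR _) => x x0 K; nra.
have Et : E t <= expR c * E 0.
  move: HH; rewrite /H mulr0 expR0 mulr1 subr_le0 mulNr expRN => HH.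
  rewrite ler_pdivrMr ?expR_gt0// in HH.
  rewrite mulrC; apply: (le_trans HH); rewrite ler_wpM2l//.
    rewrite /E addr_ge0 ?mulr_ge0 ?sqr_ge0//.
    by apply: sumr_ge0 => i _; exact: sqr_ge0.
  rewrite ler_expR ler_piMr//; first by rewrite /c !addr_ge0 ?mulr_ge0 ?addr_ge0
    ?mulr_ge0.
  by have /andP[] := t01.
have [N0|N0] := eqVneq N 0.
  apply: rV_norm_le => [|i]; last by have := ltn_ord i; rewrite {2}N0.
  by rewrite mulr_ge0 ?addr_ge0// (le_trans _ C2ge1).
rewrite -(@ler_pXn2r _ 2)// ?nnegrE ?mulr_ge0 ?addr_ge0 ?(le_trans _ C2ge1)//.
have := g_le t; rewrite N0 mulr1 => /le_trans -> //.
have : \sum_(i < N) (g t 0 i) ^+ 2 <= E t by rewrite lerDl mulr_ge0 ?sqr_ge0.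
move=> /le_trans -> //; apply: (le_trans Et).
apply: (@le_trans _ _ (expR c * (N%:R * (`|g 0| + e) ^+ 2))).
  by rewrite ler_wpM2l// expR_ge0.
rewrite mulrA exprMn ler_wpM2r ?sqr_ge0//.
apply: (@le_trans _ _ C2); first by rewrite lerDl.
by rewrite expr2 ler_peMr// (le_trans _ C2ge1).
Qed.

Lemma exp2_small (R : realType) (M e : R) : 0 < e -> exists k, M / 2 ^+ k < e.
Proof.
move=> e0; pose k := Num.bound (`|M| / e); exists k.
rewrite ltr_pdivrMr ?exprn_gt0// mulrC -ltr_pdivrMr//.
apply: le_lt_trans (_ : `|M| / e < 2 ^+ k).
  by rewrite ler_wpM2r ?ler_norm// invr_ge0 ltW.
apply: lt_trans (archi_boundP _) _; first by rewrite divr_ge0// ltW.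
by rewrite -natrX ltr_nat ltn_expl.
Qed.

(** The radius [2 M / 2^k] is the sum of all steps from the [k]-th on, so the intervals of that
    radius around [a k] are nested; [l] is the supremum of their left ends [b k]. *)
Lemma geometric_limit (R : realType) (a : nat -> R) (M : R) :
  (forall k, `|a k.+1 - a k| <= M / 2 ^+ k) ->
  exists l, forall k, `|a k - l| <= 2 * M / 2 ^+ k.
Proof.
move=> aM; pose b k := a k - 2 * M / 2 ^+ k; pose c k := a k + 2 * M / 2 ^+ k.
have H (k : nat) : 2 * M / 2 ^+ k.+1 = M / 2 ^+ k :> R.
  by rewrite exprS invfM; field; rewrite expf_neq0.
have M0 k : 0 <= M / 2 ^+ k by apply: le_trans (aM k).
have bS k : b k <= b k.+1.
  by have := aM k; rewrite ler_norml /b H; have := M0 k; lra.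
have cS k : c k.+1 <= c k.
  by have := aM k; rewrite ler_norml /c H; have := M0 k; lra.
have bmono j k : (j <= k)%N -> b j <= b k.
  by apply: (@homo_leq _ b (fun x y => x <= y)) => //; exact: le_trans.
have cmono j k : (j <= k)%N -> c k <= c j.
  apply: (@homo_leq _ c (fun x y => y <= x)) => // x y z xy yz.
  exact: le_trans yz xy.
have bc j k : b j <= c k.
  apply: (le_trans (bmono _ _ (leq_maxl j k))).
  apply: le_trans (cmono _ _ (leq_maxr j k)).
  by have := M0 (maxn j k); rewrite /b /c; lra.
have ubc k : ubound (range b) (c k) by move=> _ [j _ <-].
have hs : has_sup (range b).
  by split; [exists (b 0), 0|exists (c 0)].
exists (sup (range b)) => k; rewrite ler_norml.
have K1 : b k <= sup (range b) by apply: sup_ubound; [exact: (proj2 hs)|exists k].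
have K2 : sup (range b) <= c k by apply: ge_sup; [exact: (proj1 hs)|exact: ubc].
by move: K1 K2; rewrite /b /c; lra.
Qed.

(* A solution on [0, 1], extended by constants to the whole line. *)
Definition is_sol (R : realType) (N : nat) (f : R -> 'rV[R]_N -> 'rV[R]_N)
    (z : 'rV[R]_N) (u : R -> 'rV[R]_N) : Prop :=
  [/\ continuous u, u 0 = z, (forall t, u t = u (clamp01 t)) &
      forall t : R, 0 < t < 1 -> forall i,
        is_derive t 1 (fun s => u s 0 i) (f t (u t) 0 i)].

Section Picard.
Context {R : realType} {N : nat}.
Variables (f : R -> 'rV[R]_N -> 'rV[R]_N) (L : R) (z : 'rV[R]_N).
Hypothesis L0 : 0 <= L.
Hypothesis cf : forall u : R -> 'rV[R]_N,
  continuous u -> continuous (fun t => f t (u t)).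
Hypothesis fL : forall t a b, `|f t a - f t b| <= L * `|a - b|.

(** Successive approximations converge on all of [0, 1] at once, whatever the size of [L], thanks to
    an exponential weight. Continuity of [f] is asked along continuous curves only, a form suited to
    the linearised equation, where [t] enters through a trajectory. *)
Lemma picard : exists u, is_sol f z u.
Proof.
(* A value is picked for every function, unconstrained on discontinuous ones, so that the operator
   [T] is total and can be iterated. *)
have /choice[prim primP] : forall g : R -> R, exists P : R -> R,
    continuous g -> [/\ continuous P, P 0 = 0, (forall t, P t = P (clamp01 t)) &
      forall t : R, 0 < t < 1 -> is_derive t 1 P (g t)].
  move=> g; have [/continuous_primitive[P HP]|ncg] := pselect (continuous g).
    by exists P.
  by exists (cst 0).
pose G (u : R -> 'rV[R]_N) i (t : R) := f t (u t) 0 i.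
have cG u i : continuous u -> continuous (G u i).
  by move=> cu t; have := continuous_coord (i := i) (@cf u cu t).
pose T (u : R -> 'rV[R]_N) (t : R) : 'rV[R]_N := z + \row_i prim (G u i) t.
have TE u t i : T u t 0 i = z 0 i + prim (G u i) t by rewrite !mxE.
have cT u : continuous u -> continuous (T u).
  move=> cu t; apply: rV_continuous => i.
  have [cP _ _ _] := primP _ (cG u i cu).
  have -> : (fun s => T u s 0 i) = cst (z 0 i) \+ prim (G u i).
    by apply/funext => s; rewrite TE.
  exact: (continuousD (@cst_continuous _ _ (z 0 i) t) (cP t)).
have T0 u : continuous u -> T u 0 = z.
  move=> cu; apply/rowP => i; rewrite TE.
  by have [_ -> _ _] := primP _ (cG u i cu); rewrite addr0.
have Tclamp u t : continuous u -> T u t = T u (clamp01 t).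
  move=> cu; apply/rowP => i; rewrite !TE.
  by have [_ _ <- _] := primP _ (cG u i cu).
have dT u (t : R) : continuous u -> 0 < t < 1 -> forall i,
    is_derive t 1 (fun s => T u s 0 i) (f t (u t) 0 i).
  move=> cu t01 i.
  have [_ _ _ dP] := primP _ (cG u i cu).
  have -> : (fun s => T u s 0 i) = cst (z 0 i) \+ prim (G u i).
    by apply/funext => s; rewrite TE.
  rewrite -[X in is_derive _ _ _ X]add0r.
  by apply: is_deriveD; exact: dP.
have Tdist u v (H dH : R -> R) : continuous u -> continuous v -> continuous H ->
    (forall t : R, 0 < t < 1 -> is_derive t 1 H (dH t)) ->
    (forall t : R, 0 < t < 1 -> L * `|u t - v t| <= dH t) ->
    forall t : R, 0 <= t <= 1 -> `|T u t - T v t| <= H t - H 0.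
  move=> cu cv cH dH' uv t t01; apply: rV_norm_le => [|i].
    have c0 : continuous (cst 0 : R -> R) by exact: cst_continuous.
    have d0 (s : R) : 0 < s < 1 -> is_derive s 1 (cst 0 : R -> R) 0.
      by move=> _; exact: is_derive_cst.
    have := derive_le c0 cH d0 dH' _ t01; rewrite subrr; apply.
    by move=> s /uv; apply: le_trans; rewrite mulr_ge0.
  pose h (s : R) := T u s 0 i - T v s 0 i.
  have ch : continuous h.
    move=> s; have cu' := continuous_coord (i := i) (cT _ cu s).
    have cv' := continuous_coord (i := i) (cT _ cv s).
    exact: (continuousB cu' cv').
  have dh (s : R) : 0 < s < 1 ->
      is_derive s 1 h (f s (u s) 0 i - f s (v s) 0 i).
    by move=> s01; apply: is_deriveB; exact: dT.
  have := derive_abs_le ch cH dh dH' _ t01.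
  rewrite {2}/h !T0// subrr subr0 /h !mxE; apply => s s01.
  apply: le_trans (uv s s01); apply: le_trans (fL s (u s) (v s)).
  by have := normr_coord (f s (u s) - f s (v s)) i; rewrite !mxE.
pose uu k := iter k T (cst z).
have cuu k : continuous (uu k).
  by elim: k => [|k IH]; [exact: cst_continuous|exact: cT].
have uuclamp k t : uu k t = uu k (clamp01 t) by case: k => [|k] //=; exact: Tclamp.
have [K KP] : exists K, forall t : R, 0 <= t <= 1 -> `|uu 1 t - uu 0 t| <= K.
  have cn : continuous (fun t => `|uu 1 t - uu 0 t|).
    move=> t; have := continuousB (cuu 1%N t) (cuu 0%N t).
    by move=> /continuous_comp; apply; exact: norm_continuous.
  have wcn : {within `[0, 1], continuous (fun t : R => `|uu 1 t - uu 0 t|)}.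
    exact: continuous_subspaceT.
  have [c _ cP] := EVT_max ler01 wcn.
  by exists (`|uu 1 c - uu 0 c|) => t t01; apply: cP; rewrite in_itv.
have K0 : 0 <= K by apply: le_trans (KP 0 _); rewrite ?lexx ?ler01.
(* The function [L * E] is the derivative of [E / 2], so [T] halves distances measured against this
   weight. *)
pose E (t : R) := expR (2 * L * t).
have dE (t : R) : is_derive t 1 E (2 * L * E t).
  have l : is_derive t 1 (fun r : R => 2 * L * r) (2 * L).
    rewrite -[X in is_derive _ _ _ X]mulr1.
    exact: (is_deriveZ (2 * L) (is_derive_id t (1 : R))).
  have := @is_derive1_comp R expR (fun r => 2 * L * r) t _ _
    (is_derive_expR _) l.
  by rewrite [X in is_derive _ _ _ X -> _]mulrC.
have cE : continuous E.
  move=> t; have [dx _] := dE t.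
  exact: (differentiable_continuous ((derivable1_diffP _ _).1 dx)).
have uuS k (t : R) : 0 <= t <= 1 ->
    `|uu k.+1 t - uu k t| <= K / 2 ^+ k * E t.
  elim: k t => [|k IH] t t01.
    rewrite expr0 divr1; apply: le_trans (KP t t01) _; rewrite ler_peMr//.
    by rewrite -expR0 ler_expR !mulr_ge0//; case/andP: t01.
  pose H (s : R) := K / 2 ^+ k.+1 * E s.
  have dH (s : R) : 0 < s < 1 -> is_derive s 1 H (K / 2 ^+ k.+1 * (2 * L * E s)).
    by move=> _; exact: (is_deriveZ (K / 2 ^+ k.+1) (dE s)).
  have cH : continuous H.
    move=> s.
    exact: (continuousM (@cst_continuous _ _ (K / 2 ^+ k.+1) s) (cE s)).
  apply: le_trans (Tdist _ _ _ _ (cuu k.+1) (cuu k) cH dH _ _ t01) _.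
    move=> s /andP[s0 s1].
    have /IH {}IH : 0 <= s <= 1 by rewrite !ltW.
    apply: le_trans (ler_wpM2l L0 IH) _.
    rewrite exprS invfM le_eqVlt; apply/orP; left; apply/eqP; field.
    by rewrite expf_neq0.
  rewrite gerBl mulr_ge0 ?expR_ge0// divr_ge0// exprn_ge0//.
pose M := K * E 1.
have uuM k t : `|uu k.+1 t - uu k t| <= M / 2 ^+ k.
  rewrite (uuclamp k) (uuclamp k.+1); apply: le_trans (uuS _ _ (clamp01_itv _)) _.
  rewrite /M mulrAC ler_wpM2r ?invr_ge0 ?exprn_ge0// ler_wpM2l//.
  rewrite ler_expR ler_wpM2l ?mulr_ge0//.
  by have /andP[] := clamp01_itv t.
have M0 : 0 <= M by rewrite mulr_ge0 ?expR_ge0.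
have /choice[l lP] : forall p : R * 'I_N, exists l, forall k,
    `|uu k p.1 0 p.2 - l| <= 2 * M / 2 ^+ k.
  move=> [t i] /=; apply: geometric_limit => k.
  apply: le_trans (uuM k t).
  by have := normr_coord (uu k.+1 t - uu k t) i; rewrite !mxE.
pose u (t : R) : 'rV[R]_N := \row_i l (t, i).
have uuu k t : `|uu k t - u t| <= 2 * M / 2 ^+ k.
  apply: rV_norm_le => [|i]; first by apply: divr_ge0;
    [exact: mulr_ge0|exact: exprn_ge0].
  by rewrite !mxE; exact: (lP (t, i) k).
have cu : continuous u.
  move=> t; apply/cvgrPdist_lt => e e0.
  have [k ke] := @exp2_small R (2 * M) (e / 3) (divr_gt0 e0 (ltr0n _ 3)).
  have e30 : 0 < e / 3 by exact: divr_gt0.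
  have /cvgrPdist_lt/(_ _ e30) := cuu k t.
  apply: (@filterS _ (nbhs t)) => s Hs.
  have -> : u t - u s = - (uu k t - u t) + (uu k t - uu k s) + (uu k s - u s).
    by rewrite opprB (addrA (u t - uu k t)) subrK addrA subrK.
  apply: le_lt_trans (ler_normD _ _) _.
  apply: le_lt_trans (lerD (ler_normD _ _) (lexx _)) _.
  rewrite normrN.
  by have := uuu k t; have := uuu k s; move: Hs ke; lra.
have uT (t : R) : 0 <= t <= 1 -> u t = T u t.
  move=> t01; apply/eqP; rewrite -subr_eq0 -normr_le0 leNgt; apply/negP => d0.
  have [k ke] := @exp2_small R (2 * M + L * (2 * M)) _ d0.
  pose c := L * (2 * M / 2 ^+ k).
  have dH (s : R) : 0 < s < 1 -> is_derive s 1 (fun r : R => c * r) c.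
    move=> _; rewrite -[X in is_derive _ _ _ X]mulr1.
    exact: (is_deriveZ c (is_derive_id s (1 : R))).
  have cH : continuous (fun r : R => c * r).
    by move=> s; exact: (continuousM (@cst_continuous _ _ c s) (@cvg_id _ _)).
  have D := Tdist _ _ _ _ (cuu k) cu cH dH.
  have {}D := D (fun s _ => ler_wpM2l L0 (uuu k s)) t t01.
  have D2 := uuu k.+1 t.
  have M2 : 2 * M / 2 ^+ k.+1 <= 2 * M / 2 ^+ k.
    apply: ler_wpM2l; first exact: mulr_ge0.
    have p j : 0 < 2 ^+ j :> R by rewrite exprn_gt0.
    by rewrite lef_pV2 ?posrE ?p// exprS ler_peMl ?ler1n ?(ltW (p _)).
  have c0 : 0 <= c.
    apply: mulr_ge0 => //; apply: divr_ge0; first exact: mulr_ge0.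
    exact: exprn_ge0.
  have ct : c * t - c * 0 <= c.
    by rewrite mulr0 subr0 ler_piMr//; case/andP: t01.
  have : `|u t - T u t| <= `|uu k.+1 t - u t| + `|T (uu k) t - T u t|.
    have -> : u t - T u t = - (uu k.+1 t - u t) + (T (uu k) t - T u t).
      by rewrite opprB addrA subrK.
    by apply: le_trans (ler_normD _ _) _; rewrite normrN.
  move: ke ct; rewrite /c mulrDl -mulrA; move: D D2 M2; rewrite /c; lra.
(* [T u] agrees with the limit [u] on [0, 1], and being built from primitives it already has the
   required derivative and is constant outside [0, 1]. *)
exists (T u); split.
- exact: cT.
- exact: T0.
- by move=> t; exact: Tclamp.
- move=> t t01 i; rewrite -uT; first exact: dT.
  by case/andP: t01 => t0 t1; rewrite !ltW.
Qed.

End Picard.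

(** * Estimates on closed balls *)

Definition cball (R : realType) n (c : 'rV[R]_n) (rho : R) : set 'rV[R]_n :=
  [set y | `|y - c| <= rho].

Lemma finite_bound (R : realType) (I : finType) (T : Type) (A : set T)
    (F : I -> T -> R) :
  (forall i, exists K, forall x, A x -> F i x <= K) ->
  exists2 K, 0 <= K & forall i x, A x -> F i x <= K.
Proof.
move=> /choice[K FK]; exists (\sum_i `|K i|); first exact: sumr_ge0.
move=> i x Ax; apply: le_trans (FK i x Ax) _; apply: le_trans (ler_norm _) _.
by rewrite (bigD1 i)//= lerDl sumr_ge0.
Qed.

Section BallEstimates.
Context {R : realType} {n : nat}.
Variables (Omega : set 'rV[R]_n) (c : 'rV[R]_n) (rho : R).
Hypotheses (oO : open Omega) (rho0 : 0 < rho) (cO : cball c rho `<=` Omega).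
Implicit Types (f : 'rV[R]_n -> R) (a b : 'rV[R]_n).

Lemma cball_segment a b (s : R) : cball c rho a -> cball c rho b -> 0 <= s <= 1 ->
  cball c rho (s *: (b - a) + a).
Proof.
move=> ca cb /andP[s0 s1]; rewrite /cball /=.
have -> : s *: (b - a) + a - c = s *: (b - c) + (1 - s) *: (a - c).
  by apply/rowP => i; rewrite !mxE; ring.
apply: le_trans (ler_normD _ _) _; rewrite !normrZ (ger0_norm s0).
rewrite (@ger0_norm _ (1 - s)) ?subr_ge0//.
have -> : rho = s * rho + (1 - s) * rho by ring.
by apply: lerD; apply: ler_wpM2l => //; rewrite subr_ge0.
Qed.

(** In the sup norm a closed ball is a product of segments. *)
Lemma cball_compact : compact (cball c rho).
Proof.
have -> : cball c rho =
    [set v : 'rV[R]_n | forall i, `[c 0 i - rho, c 0 i + rho]%classic (v ord0 i)].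
  apply/seteqP; split=> [v cv i|v H].
    rewrite /= in_itv /= -ler_distlC distrC.
    by apply: le_trans cv; have := normr_coord (v - c) i; rewrite !mxE.
  apply: rV_norm_le => [|i]; first exact: ltW.
  by have := H i; rewrite /= in_itv /= -ler_distlC distrC !mxE.
apply: (@rV_compact R n (fun i => `[c 0 i - rho, c 0 i + rho]%classic)) => i.
exact: segment_compact.
Qed.

Lemma continuous_cball_bounded f : (forall x, Omega x -> {for x, continuous f}) ->
  exists K, forall x, cball c rho x -> `|f x| <= K.
Proof.
move=> cf.
have cnf : {within cball c rho, continuous (fun x => `|f x|)}.
  apply: continuous_in_subspaceT => x; rewrite inE => /cO /cf cfx.
  exact: (continuous_comp cfx (@norm_continuous _ _ _)).
have ne : cball c rho !=set0 by exists c; rewrite /cball /= subrr normr0 ltW.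
have [d _ dP] := EVT_max_rV ne cball_compact cnf.
by exists (`|f d|) => x cx; apply: dP; rewrite inE.
Qed.

Lemma mean_value_cball f a b : Cr 1 Omega f -> cball c rho a -> cball c rho b ->
  exists2 y, cball c rho y /\ `|y - a| <= `|b - a| &
    f b - f a = \sum_j (b - a) 0 j * partial j f y.
Proof.
move=> Cf ca cb; pose g (r : R) : R := f (r *: (b - a) + a).
have dg (s : R) : 0 <= s <= 1 ->
    is_derive s (1 : R) g ('D_(b - a) f (s *: (b - a) + a)).
  move=> s01; apply: is_derive_line; apply: diff_derivable.
  by apply: (Cr_differentiable oO Cf); apply: cO; exact: cball_segment.
have cg : {within `[0, 1], continuous g}.
  apply: derivable_within_continuous => s; rewrite in_itv /= => /dg[].
  by [].
have [||s] := @MVT_segment R g (fun s => 'D_(b - a) f (s *: (b - a) + a)) 0 1 ler01.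
- move=> s; rewrite in_itv /= => /andP[s0 s1]; apply: dg.
  by rewrite !ltW.
- exact: cg.
rewrite in_itv /= => s01; rewrite /g scale0r add0r scale1r subrK subr0 mulr1 => ->.
exists (s *: (b - a) + a).
  split; first exact: cball_segment.
  rewrite addrK normrZ; have /andP[s0 s1] := s01.
  by rewrite ger0_norm// ler_piMl.
rewrite derive_sum_partial//.
by apply: (Cr_differentiable oO Cf); apply: cO; exact: cball_segment.
Qed.

Lemma lipschitz_cball f : Cr 1 Omega f -> exists2 K, 0 <= K &
  forall a b, cball c rho a -> cball c rho b -> `|f b - f a| <= K * `|b - a|.
Proof.
move=> Cf.
have [K K0 KP] : exists2 K, 0 <= K & forall (j : 'I_n) x, cball c rho x ->
    `|partial j f x| <= K.
  apply: finite_bound => j.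
  apply: (@continuous_cball_bounded (partial j f)) => x Ox.
  by have [_ /(_ j)[_ [cj _]]] := Cf; exact: cj.
exists (n%:R * K) => [|a b ca cb]; first exact: mulr_ge0.
have [y [cy _] ->] := mean_value_cball Cf ca cb.
by apply: sum_coord_le => j; exact: KP.
Qed.

(** In the mean value formula the partial derivatives are taken at a point [y] no farther from [a]
    than [b] is; moving them to [a] costs a further factor [|b - a|], because they are themselves
    Lipschitz. *)
Lemma taylor_cball f : Cr 2 Omega f -> exists2 K, 0 <= K &
  forall a b, cball c rho a -> cball c rho b ->
    `|f b - f a - \sum_j (b - a) 0 j * partial j f a| <= K * `|b - a| ^+ 2.
Proof.
move=> Cf.
have [K K0 KP] : exists2 K, 0 <= K & forall (j : 'I_n) a b,
    cball c rho a -> cball c rho b ->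
    `|partial j f b - partial j f a| <= K * `|b - a|.
  have /choice[K KP] : forall j : 'I_n, exists K, 0 <= K /\ forall a b,
      cball c rho a -> cball c rho b ->
      `|partial j f b - partial j f a| <= K * `|b - a|.
    move=> j; have [_ /(_ j)[_ Cj]] := Cf.
    by have [K K0 KP] := lipschitz_cball Cj; exists K.
  exists (\sum_j K j) => [|j a b ca cb].
    by apply: sumr_ge0 => j _; exact: (KP j).1.
  apply: le_trans ((KP j).2 a b ca cb) _; apply: ler_wpM2r => //.
  by rewrite (bigD1 j)//= lerDl; apply: sumr_ge0 => i _; exact: (KP i).1.
exists (n%:R * K) => [|a b ca cb]; first exact: mulr_ge0.
have [y [cy yab] ->] := mean_value_cball (Cr_pred Cf) ca cb.
rewrite -sumrB (eq_bigr (fun j => (b - a) 0 j * (partial j f y - partial j f a))).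
  rewrite expr2 mulrA -(mulrA n%:R); apply: sum_coord_le => j.
  apply: le_trans (KP j a y ca cy) _; exact: ler_wpM2l.
by move=> j _; rewrite mulrBr.
Qed.

End BallEstimates.

(** * Smooth dependence of flows on initial conditions *)

(* The factor [k] is there because the linearised flow will only be available
   for small tangent vectors. *)
Lemma quadratic_is_derive (R : realType) (V : normedModType R) (f : V -> R)
    (z v : V) (k d M : R) : k != 0 ->
  (\forall h \near (0 : R), `|f (h *: (k *: v) + z) - f z - h * d| <= M * h ^+ 2) ->
  is_derive z v f (d / k).
Proof.
move=> k0 /nbhs_normP[e /= e0 fM].
have k1 : 0 < `|k| by rewrite normr_gt0.
suff cv : h^-1 *: (f (h *: v + z) - f z) @[h --> (0 : R)^'] --> d / k.
  by split; [apply/cvg_ex; exists (d / k)|exact/cvg_lim].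
apply/cvgrPdist_le => e' e'0.
pose M' := `|M| / `|k| ^+ 2 + 1.
have M'0 : 0 < M' by rewrite ltr_pwDr// divr_ge0// exprn_ge0.
near=> h.
have h0 : h != 0 by near: h; exact: nbhs_dnbhs_neq.
have he : `|h / k| < e.
  rewrite normf_div ltr_pdivrMr//; near: h; apply: dnbhs0_lt.
  exact: mulr_gt0.
have he' : `|h| <= e' / M'.
  near: h; apply: dnbhs0_le; exact: divr_gt0.
have := fM (h / k); rewrite /= sub0r normrN => /(_ he).
rewrite scalerA divfK// => H.
have h1 : 0 < `|h| by rewrite normr_gt0.
rewrite -(ler_pM2l h1) -normrM mulrBr.
have -> : h * (h^-1 *: (f (h *: v + z) - f z)) = f (h *: v + z) - f z.
  by rewrite /GRing.scale /= mulrA mulfV// mul1r.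
rewrite distrC mulrA mulrAC.
apply: (le_trans H).
rewrite exprMn exprVn.
rewrite ler_pdivlMr// in he'.
apply: le_trans (_ : `|h| * (`|h| * M') <= _); last by rewrite ler_pM2l.
rewrite mulrA -expr2 real_normK ?num_real// mulrCA ler_wpM2l ?sqr_ge0//.
rewrite /M' ler_wpDr// real_normK ?num_real//.
by rewrite ler_wpM2r ?invr_ge0 ?sqr_ge0// ler_norm.
Unshelve. all: by end_near. Qed.

Definition linearized (R : realType) n p (F : 'rV[R]_n -> 'rV[R]_p)
    (y w : 'rV[R]_n) : 'rV[R]_p :=
  \row_l \sum_j w 0 j * partial j (fun x => F x 0 l) y.

(** [Q] confines the trajectories to where the estimates on [F] hold. As [is_sol] freezes solutions
    outside [0, 1], this can be asked at every real [t]. *)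
Definition flow_in (R : realType) n (F : 'rV[R]_n -> 'rV[R]_n)
    (D Q : set 'rV[R]_n) (phi : R -> 'rV[R]_n -> 'rV[R]_n) : Prop :=
  forall z, D z -> is_sol (fun=> F) z (phi^~ z) /\ forall t, Q (phi t z).

Section Flow.
Context {R : realType} {n : nat}.
Variables (Omega : set 'rV[R]_n) (c : 'rV[R]_n) (rho : R).
Variables (F : 'rV[R]_n -> 'rV[R]_n) (D : set 'rV[R]_n).
Variable phi : R -> 'rV[R]_n -> 'rV[R]_n.
Hypotheses (oO : open Omega) (rho0 : 0 < rho) (cO : cball c rho `<=` Omega).
Hypothesis sF : forall l, smooth Omega (fun x => F x 0 l).
Hypothesis flowP : flow_in F D (cball c rho) phi.

Lemma field_lipschitz : exists2 K, 0 <= K & forall a b, cball c rho a ->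
  cball c rho b -> `|F b - F a| <= K * `|b - a|.
Proof.
have /choice[K KP] : forall l : 'I_n, exists K, 0 <= K /\ forall a b,
    cball c rho a -> cball c rho b -> `|F b 0 l - F a 0 l| <= K * `|b - a|.
  by move=> l; have [K K0 KP] := lipschitz_cball oO rho0 cO (sF l 1); exists K.
have S0 : 0 <= \sum_l K l by apply: sumr_ge0 => l _; exact: (KP l).1.
exists (\sum_l K l) => // a b ca cb.
apply: rV_norm_le => [|l]; first exact: mulr_ge0.
rewrite !mxE; apply: le_trans ((KP l).2 a b ca cb) _; apply: ler_wpM2r => //.
by rewrite (bigD1 l)//= lerDl; apply: sumr_ge0 => i _; exact: (KP i).1.
Qed.

Lemma linearized_bound : exists2 K, 0 <= K & forall a w, cball c rho a ->
  `|linearized F a w| <= K * `|w|.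
Proof.
have [K K0 KP] : exists2 K, 0 <= K & forall (p : 'I_n * 'I_n) x, cball c rho x ->
    `|partial p.1 (fun x => F x 0 p.2) x| <= K.
  apply: finite_bound => -[j l] /=.
  apply: (continuous_cball_bounded rho0 cO) => x Ox.
  by have [_ /(_ j)[_ [cj _]]] := sF l 1; exact: cj.
exists (n%:R * K) => [|a w ca]; first exact: mulr_ge0.
apply: rV_norm_le => [|l]; first by rewrite !mulr_ge0.
by rewrite mxE; apply: sum_coord_le => j; exact: (KP (j, l)).
Qed.

Lemma field_taylor : exists2 K, 0 <= K & forall a b, cball c rho a ->
  cball c rho b -> `|F b - F a - linearized F a (b - a)| <= K * `|b - a| ^+ 2.
Proof.
have /choice[K KP] : forall l : 'I_n, exists K, 0 <= K /\ forall a b,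
    cball c rho a -> cball c rho b ->
    `|F b 0 l - F a 0 l - \sum_j (b - a) 0 j * partial j (fun x => F x 0 l) a|
      <= K * `|b - a| ^+ 2.
  by move=> l; have [K K0 KP] := taylor_cball oO rho0 cO (sF l 2); exists K.
have S0 : 0 <= \sum_l K l by apply: sumr_ge0 => l _; exact: (KP l).1.
exists (\sum_l K l) => // a b ca cb.
apply: rV_norm_le => [|l]; first by rewrite mulr_ge0// sqr_ge0.
have -> : (F b - F a - linearized F a (b - a)) 0 l = F b 0 l - F a 0 l -
    \sum_j (b - a) 0 j * partial j (fun x => F x 0 l) a by rewrite !mxE.
apply: le_trans ((KP l).2 a b ca cb) _; apply: ler_wpM2r; first exact: sqr_ge0.
by rewrite (bigD1 l)//= lerDl; apply: sumr_ge0 => i _; exact: (KP i).1.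
Qed.

Lemma flow_lipschitz : exists2 C, 0 < C & forall z z' t, D z -> D z' ->
  `|phi t z - phi t z'| <= C * `|z - z'|.
Proof.
have [K K0 KP] := field_lipschitz; have [C C0 CP] := gronwall n K0.
exists C => // z z' t Dz Dz'.
have [[cz z0 zc dz] Qz] := flowP Dz; have [[cz' z0' zc' dz'] Qz'] := flowP Dz'.
rewrite zc zc'.
have := CP (fun s => phi s z - phi s z') (fun s => F (phi s z) - F (phi s z')) 0
  (lexx 0).
rewrite z0 z0' addr0; apply; last exact: clamp01_itv.
- by move=> s; exact: (continuousB (cz s) (cz' s)).
- move=> s s01 i; rewrite !mxE.
  have -> : (fun s => (phi s z - phi s z') 0 i) =
      (fun s => phi s z 0 i) - (fun s => phi s z' 0 i).
    by apply/funext => r; rewrite !mxE.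
  by apply: is_deriveB; [exact: dz|exact: dz'].
- by move=> s s01; rewrite addr0; exact: KP.
Qed.

(** A linear equation whose coefficients are bounded along the trajectory is globally Lipschitz in
    [w], so [picard] applies without any truncation. *)
Lemma linearized_sol z v : D z ->
  exists w, is_sol (fun t w => linearized F (phi t z) w) v w.
Proof.
move=> Dz; have [[cz _ _ _] Qz] := flowP Dz.
have [K K0 KP] := linearized_bound.
apply: (picard v K0) => [u cu t|t a b].
  apply: rV_continuous => l.
  have -> : (fun s => linearized F (phi s z) (u s) 0 l) =
      (fun s => \sum_j u s 0 j * partial j (fun x => F x 0 l) (phi s z)).
    by apply/funext => s; rewrite mxE.
  apply: continuous_bigsum => j.
  have c1 := continuous_coord (i := j) (cu t).
  have [_ /(_ j)[_ [cj _]]] := sF l 1.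
  have c2 := continuous_comp (cz t) (cj _ (cO (Qz t))).
  exact: (continuousM c1 c2).
have -> : linearized F (phi t z) a - linearized F (phi t z) b =
    linearized F (phi t z) (a - b).
  apply/rowP => l; rewrite !mxE -sumrB; apply: eq_bigr => j _.
  by rewrite !mxE mulrBl.
exact: KP.
Qed.

Lemma linearized_sol_bound : exists2 C, 0 < C & forall z v w, D z ->
  is_sol (fun t w => linearized F (phi t z) w) v w ->
  forall t, `|w t| <= C * `|v|.
Proof.
have [K K0 KP] := linearized_bound; have [C C0 CP] := gronwall n K0.
exists C => // z v w Dz [cw w0 wc dw] t; rewrite wc -w0.
have := CP w (fun s => linearized F (phi s z) (w s)) 0 (lexx 0) cw dw.
rewrite addr0; apply; last exact: clamp01_itv.
by move=> s s01; rewrite addr0; apply: KP; have [_] := flowP Dz.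
Qed.

(** The remainder [g] starts at 0 and solves the linearised equation up to the Taylor error of [F].
    That error is quadratic in the distance of the two trajectories, hence in [h] by
    [flow_lipschitz], and Gronwall's inequality transfers the bound to [g]. *)
Lemma flow_estimate z v w : open D -> D z ->
  is_sol (fun t w => linearized F (phi t z) w) v w ->
  exists M, forall t l, \forall h \near (0 : R),
    `|phi t (h *: v + z) 0 l - phi t z 0 l - h * w t 0 l| <= M * h ^+ 2.
Proof.
move=> oD Dz [cw w0 wc dw].
have [K1 K10 K1P] := field_taylor; have [K2 K20 K2P] := linearized_bound.
have [C1 C10 C1P] := flow_lipschitz; have [C C0 CP] := gronwall n K20.
pose M := C * (K1 * (C1 * `|v|) ^+ 2).
exists M => t l.
have nD : \forall h \near (0 : R), D (h *: v + z).
  have : {for (0 : R), continuous (fun h : R => h *: v + z)}.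
    have cs : {for (0 : R), continuous (fun h : R => h *: v)}.
      exact: scalel_continuous.
    exact: (continuousD cs (@cst_continuous _ _ z (0 : R))).
  apply; rewrite scale0r add0r; exact: open_nbhs_nbhs.
apply: (@filterS _ (nbhs (0 : R)) _ _ _ _ nD) => h Dh.
have [[cz z0 zc dz] Qz] := flowP Dz; have [[ch h0 hc dh] Qh] := flowP Dh.
pose g s := phi s (h *: v + z) - phi s z - h *: w s.
pose dg s := F (phi s (h *: v + z)) - F (phi s z)
  - h *: linearized F (phi s z) (w s).
have g0 : g 0 = 0 by rewrite /g h0 z0 w0 addrK subrr.
have cg : continuous g.
  move=> s; have c1 := continuousB (ch s) (cz s).
  have c2 : {for s, continuous (fun s => h *: w s)}.
    exact: (continuousZl_tmp (k := h) (cw s)).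
  exact: (continuousB c1 c2).
pose e := K1 * (C1 * (`|h| * `|v|)) ^+ 2.
have e0 : 0 <= e by rewrite mulr_ge0// sqr_ge0.
have ddg (s : R) : 0 < s < 1 -> forall i,
    is_derive s 1 (fun r => g r 0 i) (dg s 0 i).
  move=> s01 i; have -> : dg s 0 i = F (phi s (h *: v + z)) 0 i -
      F (phi s z) 0 i - h *: (linearized F (phi s z) (w s) 0 i).
    by rewrite /dg !mxE.
  have -> : (fun r => g r 0 i) =
      (fun r => phi r (h *: v + z) 0 i) - (fun r => phi r z 0 i)
      - h \*: (fun r => w r 0 i).
    by apply/funext => r; rewrite !mxE.
  apply: is_deriveB; first by apply: is_deriveB; [exact: dh|exact: dz].
  by apply: is_deriveZ; exact: dw.
have dg_le (s : R) : 0 < s < 1 -> `|dg s| <= K2 * `|g s| + e.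
  move=> s01.
  have -> : dg s = linearized F (phi s z) (g s) +
      (F (phi s (h *: v + z)) - F (phi s z)
       - linearized F (phi s z) (phi s (h *: v + z) - phi s z)).
    apply/rowP => i; rewrite /dg /g !mxE.
    rewrite [RHS]addrCA; congr (_ + _).
    rewrite -sumrB mulr_sumr -sumrN; apply: eq_bigr => j _.
    by rewrite !mxE; ring.
  apply: le_trans (ler_normD _ _) _; apply: lerD; first exact: K2P.
  apply: le_trans (K1P _ _ (Qz s) (Qh s)) _; apply: ler_wpM2l => //.
  rewrite lerXn2r ?nnegrE// ?mulr_ge0 ?(ltW C10)//.
  have := C1P (h *: v + z) z s Dh Dz.
  by rewrite addrK normrZ.
have := CP g dg e e0 cg ddg dg_le (clamp01 t) (clamp01_itv t).
rewrite g0 normr0 add0r => H.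
have -> : M * h ^+ 2 = C * e.
  by rewrite /M /e !exprMn real_normK ?num_real//; ring.
apply: le_trans H; have := normr_coord (g (clamp01 t)) l.
by rewrite /g -hc -zc -wc !mxE.
Qed.

End Flow.

(** * The tangent system of a vector field *)

Lemma continuous_dist (R : realType) (T : topologicalType) (V : normedModType R)
    (G : T -> V) (x : T) :
  (forall e : R, 0 < e -> \forall y \near x, `|G x - G y| < e) ->
  {for x, continuous G}.
Proof. by move=> cG; apply/cvgrPdist_lt. Qed.

Section PairField.
Context {R : realType} {n : nat}.
Implicit Types (a b y : 'rV[R]_n).

Lemma normr_row_mx_le a b (e : R) : 0 <= e -> `|a| <= e -> `|b| <= e ->
  `|row_mx a b| <= e.
Proof.
move=> e0 ae be; apply: rV_norm_le => // i; rewrite mxE.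
case: (fintype.split i) => j.
  by apply: le_trans ae; exact: normr_coord.
by apply: le_trans be; exact: normr_coord.
Qed.

Lemma normr_lsubmx_le (y : 'rV[R]_(n + n)) : `|lsubmx y| <= `|y|.
Proof. by apply: rV_norm_le => // i; rewrite mxE; exact: normr_coord. Qed.

Lemma normr_rsubmx_le (y : 'rV[R]_(n + n)) : `|rsubmx y| <= `|y|.
Proof. by apply: rV_norm_le => // i; rewrite mxE; exact: normr_coord. Qed.

(** The tangent lift of [F]: its flow moves a point by the flow of [F] and a vector at that point by
    the derivative of this flow. *)
Definition pair_field (F : 'rV[R]_n -> 'rV[R]_n) (y : 'rV[R]_(n + n)) :
    'rV[R]_(n + n) :=
  row_mx (F (lsubmx y)) (linearized F (lsubmx y) (rsubmx y)).

Lemma lsubmx_continuous : continuous (lsubmx : 'rV[R]_(n + n) -> 'rV[R]_n).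
Proof.
apply: (@lipschitz_continuous _ _ _ _ 1) => x y; rewrite mul1r.
have -> : lsubmx x - lsubmx y = lsubmx (x - y).
  by apply/rowP => i; rewrite !mxE.
exact: normr_lsubmx_le.
Qed.

Lemma rsubmx_continuous : continuous (rsubmx : 'rV[R]_(n + n) -> 'rV[R]_n).
Proof.
apply: (@lipschitz_continuous _ _ _ _ 1) => x y; rewrite mul1r.
have -> : rsubmx x - rsubmx y = rsubmx (x - y).
  by apply/rowP => i; rewrite !mxE.
exact: normr_rsubmx_le.
Qed.

(** The tangent component is left free, since [pair_field] is linear in it. *)
Definition lsub_preimage (Omega : set 'rV[R]_n) : set 'rV[R]_(n + n) :=
  [set y : 'rV[R]_(n + n) | Omega (lsubmx y)].

Lemma open_lsub_preimage Omega : open Omega -> open (lsub_preimage Omega).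
Proof.
move=> oO; apply: (@open_comp _ _ (lsubmx : 'rV[R]_(n + n) -> _)) => // x _.
exact: lsubmx_continuous.
Qed.

Lemma pair_field_smooth (Omega : set 'rV[R]_n) (F : 'rV[R]_n -> 'rV[R]_n) :
  open Omega -> (forall l, smooth Omega (fun x => F x 0 l)) ->
  forall l, smooth (lsub_preimage Omega)
    (fun y : 'rV[R]_(n + n) => pair_field F y 0 l).
Proof.
move=> oO sF l r.
have oO' := open_lsub_preimage oO.
have Cl j : Cr r (lsub_preimage Omega)
    (fun y : 'rV[R]_(n + n) => lsubmx y 0 j).
  by apply: Cr_eq_on (Cr_coord r _ (lshift n j)) => // x _; rewrite mxE.
have Cr' j : Cr r (lsub_preimage Omega)
    (fun y : 'rV[R]_(n + n) => rsubmx y 0 j).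
  by apply: Cr_eq_on (Cr_coord r _ (rshift n j)) => // x _; rewrite mxE.
rewrite -(splitK l); case: (fintype.split l) => j /=.
  apply: (Cr_eq_on (f := (fun x => F x 0 j) \o lsubmx)) => //.
    by move=> x _ /=; rewrite /pair_field row_mxEl.
  exact: (Cr_comp oO oO' (fun x H => H) (sF j r) Cl).
apply: (Cr_eq_on (f := fun y : 'rV[R]_(n + n) => \sum_i rsubmx y 0 i
    * (partial i (fun x => F x 0 j) \o lsubmx) y)) => //.
  by move=> x _ /=; rewrite /pair_field row_mxEr [in RHS]mxE.
apply: Cr_sum => // i _; apply: CrM => //.
apply: (Cr_comp (Omega := Omega)) => //.
by have [_ /(_ i)[]] := sF j r.+1.
Qed.

End PairField.

Section FlowSmooth.
Context {R : realType}.

(** Any solution [w] is accepted, so one written down by hand is recognised as a derivative of the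
    flow without a separate uniqueness argument. *)
Lemma flow_derive n (Omega : set 'rV[R]_n) (c : 'rV[R]_n) (rho : R)
    (F : 'rV[R]_n -> 'rV[R]_n) D phi z v w :
  open Omega -> 0 < rho -> cball c rho `<=` Omega ->
  (forall l, smooth Omega (fun x => F x 0 l)) ->
  open D -> flow_in F D (cball c rho) phi -> D z ->
  is_sol (fun t w => linearized F (phi t z) w) v w ->
  forall t l, is_derive z v (fun z => phi t z 0 l) (w t 0 l).
Proof.
move=> oO r0 cO sF oD fP Dz solw t l.
have [M MP] := flow_estimate oO r0 cO sF fP oD Dz solw.
rewrite -[w t 0 l]divr1; apply: (@quadratic_is_derive _ _ _ _ _ 1 _ M).
  exact: oner_neq0.
by rewrite scale1r; exact: MP.
Qed.

Lemma flow_continuous n (Omega : set 'rV[R]_n) (c : 'rV[R]_n) (rho : R)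
    (F : 'rV[R]_n -> 'rV[R]_n) D phi :
  open Omega -> 0 < rho -> cball c rho `<=` Omega ->
  (forall l, smooth Omega (fun x => F x 0 l)) ->
  open D -> flow_in F D (cball c rho) phi ->
  forall t l z, D z -> {for z, continuous (fun z => phi t z 0 l)}.
Proof.
move=> oO r0 cO sF oD fP t l z Dz.
have [C C0 CP] := flow_lipschitz oO r0 cO sF fP.
apply/continuous_coord/continuous_dist => e e0.
have d0 : 0 < e / C by exact: divr_gt0.
have nD : nbhs z D by exact: open_nbhs_nbhs.
have nd : \forall y \near z, `|z - y| < e / C.
  by apply/nbhs_normP; exists (e / C).
apply: (@filterS _ (nbhs z) (@nbhs_filter _ z) _ _ _ (filterI nD nd)) => y.
move=> [Dy zy].
by apply: le_lt_trans (CP _ _ t Dz Dy) _; rewrite mulrC -ltr_pdivlMr.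
Qed.

(* The partial derivatives of the flow are components of the flow of [pair_field],
   hence of class C^r by induction; [k] makes the tangent vector [k e_j] so
   small that its image under the linearised flow stays in the ball. *)
Lemma flow_Cr r n (Omega : set 'rV[R]_n) (c : 'rV[R]_n) (rho : R)
    (F : 'rV[R]_n -> 'rV[R]_n) D phi :
  open Omega -> 0 < rho -> cball c rho `<=` Omega ->
  (forall l, smooth Omega (fun x => F x 0 l)) ->
  open D -> flow_in F D (cball c rho) phi ->
  forall t l, Cr r D (fun z => phi t z 0 l).
Proof.
elim: r n Omega c F D phi => [|r IH] n Omega c F D phi oO r0 cO sF oD fP t l.
  by split=> //; exact: (flow_continuous oO r0 cO sF oD fP).
have [C C0 CP] := linearized_sol_bound r0 cO sF fP.
pose e := rho / C; have e0 : 0 < e by exact: divr_gt0.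
have [w wP] : exists w, forall z v, D z ->
    is_sol (fun t w => linearized F (phi t z) w) v (w z v).
  have /choice[w wP] : forall p : 'rV[R]_n * 'rV[R]_n, exists w, D p.1 ->
      is_sol (fun t w => linearized F (phi t p.1) w) p.2 w.
    move=> [z v] /=; have [Dz|nDz] := pselect (D z).
      by have [w wP] := linearized_sol r0 cO sF fP v Dz; exists w.
    by exists (cst 0).
  by exists (fun z v => w (z, v)) => z v; exact: (wP (z, v)).
pose D' : set 'rV[R]_(n + n) := [set y | D (lsubmx y) /\ `|rsubmx y| < e].
have oD' : open D'.
  apply: (@openI _ (lsub_preimage D)
    [set y : 'rV[R]_(n + n) | [set v : 'rV[R]_n | `|v| < e] (rsubmx y)]).
    exact: open_lsub_preimage.
  apply: (@open_comp _ _ (rsubmx : 'rV[R]_(n + n) -> 'rV[R]_n)) => [x _|].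
    exact: rsubmx_continuous.
  have -> : [set v : 'rV[R]_n | `|v| < e] = ball 0 e.
    by apply/seteqP; split => v; rewrite -ball_normE /= sub0r normrN.
  exact: ball_open.
have oO' := open_lsub_preimage oO.
(* In the sup norm the ball of radius [rho] around [(c, 0)] is the product of the ball around [c]
   and of the tangent vectors of norm at most [rho]. By the bound [C], vectors shorter than
   [e = rho / C] stay among the latter. *)
pose c' : 'rV[R]_(n + n) := row_mx c 0.
have cO' : cball c' rho `<=` lsub_preimage Omega.
  move=> y yc; apply: cO; rewrite /cball /=; apply: le_trans yc.
  have -> : lsubmx y - c = lsubmx (y - c').
    by apply/rowP => i; rewrite !mxE (unsplitK (inl i)).
  exact: normr_lsubmx_le.
pose phi' (t : R) (y : 'rV[R]_(n + n)) : 'rV[R]_(n + n) :=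
  row_mx (phi t (lsubmx y)) (w (lsubmx y) (rsubmx y) t).
have fP' : flow_in (pair_field F) D' (cball c' rho) phi'.
  move=> y [Dy ye].
  have [[cz z0 zc dz] Qz] := fP _ Dy.
  have [cw w0 wc dw] := wP _ (rsubmx y) Dy.
  split.
    split.
    - move=> s; apply: rV_continuous => i; rewrite -(splitK i).
      case: (fintype.split i) => j /=.
        have -> : (fun s => phi' s y 0 (lshift n j)) =
            (fun s => phi s (lsubmx y) 0 j).
          by apply/funext => q; rewrite /phi' row_mxEl.
        exact: (continuous_coord (cz s)).
      have -> : (fun s => phi' s y 0 (rshift n j)) =
          (fun s => w (lsubmx y) (rsubmx y) s 0 j).
        by apply/funext => q; rewrite /phi' row_mxEr.
      exact: (continuous_coord (cw s)).
    - by rewrite /phi' z0 w0 hsubmxK.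
    - by move=> s; rewrite /phi' zc wc.
    - move=> s s01 i; rewrite -(splitK i); case: (fintype.split i) => j /=.
        have -> : (fun s => phi' s y 0 (lshift n j)) =
            (fun s => phi s (lsubmx y) 0 j).
          by apply/funext => q; rewrite /phi' row_mxEl.
        rewrite /pair_field row_mxEl /phi' row_mxKl; exact: dz.
      have -> : (fun s => phi' s y 0 (rshift n j)) =
          (fun s => w (lsubmx y) (rsubmx y) s 0 j).
        by apply/funext => q; rewrite /phi' row_mxEr.
      rewrite /pair_field row_mxEr /phi' row_mxKl row_mxKr; exact: dw.
  move=> s; rewrite /cball /= /phi' /c' opp_row_mx add_row_mx subr0.
  apply: normr_row_mx_le; [exact: ltW|exact: Qz|].
  apply: le_trans (CP _ _ _ Dy (wP _ (rsubmx y) Dy) s) _.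
  by rewrite mulrC -ler_pdivlMr// ltW.
have C' := IH _ _ _ _ _ _ oO' r0 cO' (pair_field_smooth oO sF) oD' fP' t.
split; first exact: (flow_continuous oO r0 cO sF oD fP).
move=> j; pose k : R := e / 2.
have k0 : 0 < k by exact: divr_gt0.
have d z : D z -> is_derive z (delta_mx 0 j) (fun z => phi t z 0 l)
    (w z (k *: delta_mx 0 j) t 0 l / k).
  move=> Dz.
  have [M MP] := flow_estimate oO r0 cO sF fP oD Dz (wP _ (k *: delta_mx 0 j) Dz).
  apply: (@quadratic_is_derive _ _ _ _ _ k _ M); first exact: lt0r_neq0.
  exact: MP.
split=> [z Dz|]; first by have [] := d z Dz.
apply: (Cr_eq_on (f := fun z => ((fun y => phi' t y 0 (rshift n l))
    \o (fun z => row_mx z (k *: delta_mx 0 j))) z * (k^-1))) => //.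
  by move=> z Dz; rewrite /partial /= /phi' row_mxEr row_mxKl row_mxKr;
    have [_ ->] := d z Dz.
apply: CrM => //; last exact: Cr_cst.
apply: (Cr_comp (Omega := D')) => //.
  move=> z Dz; rewrite /D' /= row_mxKl row_mxKr; split => //.
  apply: le_lt_trans (_ : k < e); last by rewrite /k; lra.
  apply: rV_norm_le => [|i]; first exact: ltW.
  rewrite !mxE normrM (gtr0_norm k0) ler_piMr ?(ltW k0)//.
  by case: (_ && _); rewrite ?normr1 ?normr0.
move=> i; rewrite -(splitK i); case: (fintype.split i) => a /=.
  by apply: Cr_eq_on (Cr_coord r _ a) => // x _; rewrite row_mxEl.
by apply: Cr_eq_on (Cr_cst _ _ ((k *: delta_mx 0 j : 'rV[R]_n) 0 a)) => // x _;
  rewrite row_mxEr.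
Qed.

End FlowSmooth.

(** * Flows near a rest point *)

Lemma is_sol_clamp (R : realType) (N : nat) (f : R -> 'rV[R]_N -> 'rV[R]_N)
    (z : 'rV[R]_N) (u : R -> 'rV[R]_N) :
  continuous u -> u 0 = z ->
  (forall t : R, 0 < t < 1 -> forall i,
    is_derive t 1 (fun s => u s 0 i) (f t (u t) 0 i)) ->
  is_sol f z (u \o clamp01).
Proof.
move=> cu u0 du.
have id01 (t : R) : 0 < t < 1 -> clamp01 t = t.
  by move=> /andP[t0 t1]; rewrite clamp_id// !ltW.
split.
- by move=> t; apply: continuous_comp; [exact: clamp_continuous|exact: cu].
- by rewrite /= clamp_id// lexx ler01.
- by move=> t /=; rewrite (clamp_id (clamp01_itv t)).
- move=> t t01 i /=; rewrite id01//.
  apply: near_eq_is_derive (du t t01 i).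
  near=> s; rewrite /= id01//; apply/andP; split.
    by near: s; apply: lt_nbhsr; case/andP: t01.
  by near: s; apply: lt_nbhsl; case/andP: t01.
Unshelve. all: by end_near. Qed.

(** Composing [F] with the coordinatewise retraction [proj] onto the ball, which is a cube, gives a
    globally Lipschitz field, solvable up to time 1. Since [z0] is at rest, Gronwall's inequality
    bounds [|sol z t - z0|] by [C * |z - z0|]; within [rho / C] of [z0] the solutions thus never
    leave the cube, where the modified field is [F] itself. *)
Lemma local_flow (R : realType) n (Omega : set 'rV[R]_n)
    (F : 'rV[R]_n -> 'rV[R]_n) (z0 : 'rV[R]_n) :
  open Omega -> Omega z0 -> (forall l, smooth Omega (fun x => F x 0 l)) ->
  F z0 = 0 ->
  exists rho D phi, [/\ 0 < rho, cball z0 rho `<=` Omega, open D, D z0 &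
    flow_in F D (cball z0 rho) phi /\ forall t, phi t z0 = z0].
Proof.
move=> oO Oz0 sF F0.
have [rho r0 cO] : exists2 rho : R, 0 < rho & cball z0 rho `<=` Omega.
  have : nbhs z0 Omega by exact: open_nbhs_nbhs.
  move=> /nbhs_normP[e /= e0 eO]; exists (e / 2); first exact: divr_gt0.
  move=> y yz; apply: eO; rewrite /= distrC; apply: le_lt_trans yz _.
  by lra.
have [K K0 KP] := field_lipschitz oO r0 cO sF.
pose proj (y : 'rV[R]_n) : 'rV[R]_n :=
  \row_i clamp (z0 0 i - rho) (z0 0 i + rho) (y 0 i).
have projQ y : cball z0 rho (proj y).
  apply: rV_norm_le => [|i]; first exact: ltW.
  rewrite !mxE distrC ler_distlC; apply: clamp_itv.
  by rewrite lerBlDr -addrA lerDl addr_ge0// ltW.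
have projK y : cball z0 rho y -> proj y = y.
  move=> cy; apply/rowP => i; rewrite mxE clamp_id// -ler_distlC distrC.
  by apply: le_trans cy; have := normr_coord (y - z0) i; rewrite !mxE.
have projL y y' : `|proj y - proj y'| <= `|y - y'|.
  apply: rV_norm_le => // i; rewrite !mxE.
  apply: le_trans (clamp_lipschitz _ _ _ _) _.
  by have := normr_coord (y - y') i; rewrite !mxE.
have FL a b : `|F (proj a) - F (proj b)| <= K * `|a - b|.
  by apply: le_trans (KP _ _ (projQ b) (projQ a)) _; exact: ler_wpM2l.
have FC : continuous (F \o proj) by exact: lipschitz_continuous FL.
have /choice[sol solP] : forall z, exists u, is_sol (fun=> F \o proj) z u.
  move=> z; apply: (picard z K0) => [u cu t|_ a b]; last exact: FL.
  exact: (continuous_comp (cu t) (FC _)).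
have [C C0 CP] := gronwall n K0.
have solz0 z t : `|sol z t - z0| <= C * `|z - z0|.
  have [cz z_0 zc dz] := solP z.
  have := CP (fun s => sol z s - z0) (fun s => (F \o proj) (sol z s)) 0 (lexx 0).
  rewrite z_0 addr0 zc; apply; last exact: clamp01_itv.
  - by move=> s; exact: (continuousB (cz s) (@cst_continuous _ _ z0 s)).
  - move=> s s01 i.
    have -> : (fun r => (sol z r - z0) 0 i) =
        (fun r => sol z r 0 i) - cst (z0 0 i).
      by apply/funext => r; rewrite !mxE.
    rewrite -[X in is_derive _ _ _ X]subr0.
    by apply: is_deriveB; exact: dz.
  - move=> s _; rewrite addr0; have := FL (sol z s) z0.
    by rewrite (projK z0) ?F0 ?subr0// /cball /= subrr normr0 ltW.
pose D : set 'rV[R]_n := [set z | `|z - z0| < rho / C].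
have d0 : 0 < rho / C by exact: divr_gt0.
exists rho, D, (fun t z => sol z t); split => //.
- have -> : D = ball z0 (rho / C).
    by apply/seteqP; split => v; rewrite /D -ball_normE /= distrC.
  exact: ball_open.
- by rewrite /D /= subrr normr0.
- split; last first.
    move=> t; have := solz0 z0 t; rewrite subrr normr0 mulr0 normr_le0 subr_eq0.
    by move/eqP.
  move=> z Dz.
  have Qz t : cball z0 rho (sol z t).
    apply: le_trans (solz0 z t) _; rewrite mulrC -ler_pdivlMr//.
    by rewrite ltW.
  split=> //; have [cz z_0 zc dz] := solP z; split=> // t t01 i.
  by have := dz t t01 i; rewrite /= projK.
Qed.

(** * Commuting frames *)

Lemma derive_sum_dir (R : realType) n k (h : 'rV[R]_n -> R) (x : 'rV[R]_n)
    (a : 'I_k -> R) (v : 'I_k -> 'rV[R]_n) : differentiable h x ->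
  'D_(\sum_i a i *: v i) h x = \sum_i a i * 'D_(v i) h x.
Proof.
move=> dh; rewrite deriveE// linear_sum; apply: eq_bigr => i _.
by rewrite linearZ deriveE.
Qed.

Lemma derive_sum_mul (R : realType) (V : normedModType R) k (g Z : 'I_k -> V -> R)
    (x v : V) : (forall b, differentiable (g b) x) ->
  (forall b, differentiable (Z b) x) ->
  'D_v (fun y => \sum_b g b y * Z b y) x =
  \sum_b ('D_v (g b) x * Z b x + g b x * 'D_v (Z b) x).
Proof.
move=> dg dZ.
have d b : is_derive x v (g b * Z b)
    (g b x *: 'D_v (Z b) x + Z b x *: 'D_v (g b) x).
  by apply: is_deriveM; apply: derivableP; exact: diff_derivable.
have -> : (fun y => \sum_b g b y * Z b y) = \sum_b (g b * Z b).
  by apply/funext => y; rewrite fct_sumE.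
rewrite derive_sum; last by move=> b; have [] := d b.
apply: eq_bigr => b _; have [_ ->] := d b.
by rewrite addrC [X in X + _]mulrC.
Qed.

Lemma open_preimage_in (R : realType) n (M : set 'rV[R]_n) (T : topologicalType)
    (h : 'rV[R]_n -> T) (O : set T) :
  open M -> (forall x, M x -> {for x, continuous h}) -> open O ->
  open [set x | M x /\ O (h x)].
Proof.
move=> oM ch oO; rewrite openE => x [Mx Ox]; rewrite /interior.
have n1 : nbhs x M by exact: open_nbhs_nbhs.
have n2 : nbhs x (h @^-1` O) by apply: (ch x Mx); exact: open_nbhs_nbhs.
exact: filterI n1 n2.
Qed.

Section FrameChange.
Context {R : realType} {n k : nat}.
Variables (Y : 'I_k -> 'rV[R]_n -> 'rV[R]_n) (g : 'I_k -> 'I_k -> 'rV[R]_n -> R).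
Variables (c : 'I_k -> 'I_k -> 'I_k -> R) (x : 'rV[R]_n).
Hypothesis dg : forall i a, differentiable (g i a) x.

Definition new_frame i y : 'rV[R]_n := \sum_a g i a y *: Y a y.
Local Notation X := new_frame.

(** The coefficient of [[X_i, X_j]] on [Y_l], that is, in the old frame and not in the new one. It
    depends on the point [x]. *)
Definition new_constant i j l : R :=
  'D_(X i x) (g j l) x - 'D_(X j x) (g i l) x +
  \sum_a \sum_b g i a x * g j b x * c a b l.

(* [Z] stands for one component of the triads: of [Y], of [C] or of [tau]; the
   term [E] is the corresponding entry of the matrix commutators. *)
Lemma frame_change (Z : 'I_k -> 'rV[R]_n -> R) (E : 'I_k -> 'I_k -> R) i j :
  (forall a, differentiable (Z a) x) ->
  (forall a b, 'D_(Y a x) (Z b) x - 'D_(Y b x) (Z a) x =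
     \sum_l c a b l * Z l x + E a b) ->
  'D_(X i x) (fun y => \sum_b g j b y * Z b y) x
    - 'D_(X j x) (fun y => \sum_b g i b y * Z b y) x =
  \sum_l new_constant i j l * Z l x
    + \sum_a \sum_b g i a x * g j b x * E a b.
Proof.
move=> dZ H.
have DX i' j' : \sum_b g j' b x * 'D_(X i' x) (Z b) x =
    \sum_a \sum_b g i' a x * g j' b x * 'D_(Y a x) (Z b) x.
  rewrite exchange_big /=; apply: eq_bigr => b _.
  rewrite /X derive_sum_dir// mulr_sumr; apply: eq_bigr => a _.
  by rewrite mulrCA mulrA.
rewrite !derive_sum_mul// !big_split /= !DX.
rewrite [X in _ - (_ + X)]exchange_big /=.
(* Solving [H] for [E] turns the claim into a linear identity between finite sums. *)
have -> : \sum_a \sum_b g i a x * g j b x * E a b =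
    \sum_a \sum_b g i a x * g j b x * 'D_(Y a x) (Z b) x
    - \sum_j0 \sum_i0 g j i0 x * g i j0 x * 'D_(Y i0 x) (Z j0) x
    - \sum_l (\sum_a \sum_b g i a x * g j b x * c a b l) * Z l x.
  have -> : \sum_l (\sum_a \sum_b g i a x * g j b x * c a b l) * Z l x =
      \sum_a \sum_b g i a x * g j b x * (\sum_l c a b l * Z l x).
    under eq_bigr do rewrite mulr_suml.
    rewrite exchange_big /=; apply: eq_bigr => a _.
    under eq_bigr do rewrite mulr_suml.
    rewrite exchange_big /=; apply: eq_bigr => b _.
    by rewrite mulr_sumr; apply: eq_bigr => l _; rewrite mulrA.
  rewrite -!sumrB; apply: eq_bigr => a _.
  rewrite -!sumrB; apply: eq_bigr => b _.
  have -> : E a b = 'D_(Y a x) (Z b) x - 'D_(Y b x) (Z a) x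
      - \sum_l c a b l * Z l x by rewrite H; ring.
  by ring.
rewrite /new_constant.
under [in RHS]eq_bigr do rewrite mulrDl mulrBl.
rewrite big_split /= sumrB.
set S1 := \sum_(b < k) 'D_(X i x) (g j b) x * Z b x.
set S2 := \sum_(b < k) 'D_(X j x) (g i b) x * Z b x.
set S3 := \sum_(l < k) _ * _; set S4 := \sum_a _; set S5 := \sum_a _.
by ring.
Qed.

End FrameChange.

Lemma row_free_columns (F : fieldType) k n (P : 'M[F]_(k, n)) :
  row_free P -> exists f : 'I_k -> 'I_n, \matrix_(i, j) P i (f j) \in unitmx.
Proof.
move=> freeP; have fullP : row_full P^T by rewrite /row_full mxrank_tr.
exists (fullrankfun fullP); rewrite -unitmx_tr.
suff -> : (\matrix_(i, j) P i (fullrankfun fullP j))^T =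
    rowsub (fullrankfun fullP) P^T by exact: fullrowsub_unit.
by apply/matrixP => i j; rewrite !mxE.
Qed.

Section FlatFrame.
Context {R : realType} {n k p : nat}.
Variables (M : set 'rV[R]_n) (Y : 'I_k -> 'rV[R]_n -> 'rV[R]_n).
Variables (A : 'I_k -> 'rV[R]_n -> 'M[R]_p) (c : 'I_k -> 'I_k -> 'I_k -> R).
Variables (x0 : 'rV[R]_n).
Hypotheses (oM : open M) (Mx0 : M x0).
Hypothesis sY : forall i l, smooth M (fun x => Y i x 0 l).
Hypothesis sA : forall i a b, smooth M (fun x => A i x a b).
Hypothesis freeY : row_free (\matrix_(i < k) Y i x0).
Hypothesis bracketY : forall x, M x -> forall i j l,
  'D_(Y i x) (fun y => Y j y 0 l) x - 'D_(Y j x) (fun y => Y i y 0 l) x =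
  \sum_m c i j m * Y m x 0 l.
Hypothesis bracketA : forall x, M x -> forall i j a b,
  'D_(Y i x) (fun y => A j y a b) x - 'D_(Y j x) (fun y => A i y a b) x =
  \sum_m c i j m * A m x a b + (A i x *m A j x - A j x *m A i x) a b.

Definition comb_A (g : 'I_k -> 'I_k -> 'rV[R]_n -> R) i (x : 'rV[R]_n) : 'M[R]_p :=
  \sum_a g i a x *: A a x.

Lemma commuting_frame : exists (f : 'I_k -> 'I_n) (U : set 'rV[R]_n)
    (g : 'I_k -> 'I_k -> 'rV[R]_n -> R),
  let X := new_frame Y g in let A' := comb_A g in
  [/\ open U, U x0, U `<=` M & forall i a, smooth U (g i a)] /\
  [/\ forall x i j, U x -> X i x 0 (f j) = (i == j)%:R,
      forall x a b, U x -> \sum_i Y a x 0 (f i) * g i b x = (a == b)%:R,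
      forall x i j l, U x -> 'D_(X i x) (fun y => X j y 0 l) x =
         'D_(X j x) (fun y => X i y 0 l) x &
      forall x i j a b, U x ->
        'D_(X i x) (fun y => A' j y a b) x - 'D_(X j x) (fun y => A' i y a b) x
        = (A' i x *m A' j x - A' j x *m A' i x) a b].
Proof.
have [f unitf] := row_free_columns freeY.
pose G x : 'M[R]_k := \matrix_(i, j) Y i x 0 (f j).
have sG r i j : Cr r M (fun x => G x i j).
  by apply: Cr_eq_on (sY i (f j) r) => // x _; rewrite mxE.
pose U := [set x | M x /\ [set d : R | d != 0] (\det (G x))].
have cdet x : M x -> {for x, continuous (fun x => \det (G x))}.
  by move=> Mx; apply: Cr_continuous (Cr_det oM (sG 0%N)) Mx.
have oU : open U.
  by apply: (open_preimage_in oM cdet); exact: open_neq.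
have UM : U `<=` M by move=> x [].
have uG x : U x -> G x \in unitmx.
  by move=> [_ /= d0]; rewrite unitmxE unitfE.
pose g i a x := invmx (G x) i a.
have sg i a : smooth U (g i a).
  move=> r; apply: Cr_invmx => // a' b'; exact: Cr_subset (sG r a' b').
have dg x i a : U x -> differentiable (g i a) x.
  by move=> Ux; exact: (Cr_differentiable oU (sg i a 1%N) Ux).
have dY x i l : U x -> differentiable (fun y => Y i y 0 l) x.
  by move=> /UM Mx; exact: (Cr_differentiable oM (sY i l 1%N) Mx).
have dA x i a b : U x -> differentiable (fun y => A i y a b) x.
  by move=> /UM Mx; exact: (Cr_differentiable oM (sA i a b 1%N) Mx).
have Ux0 : U x0.
  split=> //=; move: unitf; rewrite unitmxE unitfE; congr (\det _ != 0).
  by apply/matrixP => i j; rewrite !mxE.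
pose X := new_frame Y g.
have XE i x l : X i x 0 l = \sum_b g i b x * Y b x 0 l.
  by rewrite /X /new_frame summxE; apply: eq_bigr => b _; rewrite mxE.
have AE i x a b : comb_A g i x a b = \sum_m g i m x * A m x a b.
  by rewrite /comb_A summxE; apply: eq_bigr => m _; rewrite mxE.
have Xf x i j : U x -> X i x 0 (f j) = (i == j)%:R.
  move=> Ux; have /matrixP/(_ i j) := mulVmx (uG x Ux).
  by rewrite !mxE XE => <-; apply: eq_bigr => b _; rewrite mxE.
have Yg x a b : U x -> \sum_i Y a x 0 (f i) * g i b x = (a == b)%:R.
  move=> Ux; have /matrixP/(_ a b) := mulmxV (uG x Ux).
  by rewrite !mxE => <-; apply: eq_bigr => i _; rewrite mxE.
have bracketY0 x l a b : U x ->
    'D_(Y a x) (fun y => Y b y 0 l) x - 'D_(Y b x) (fun y => Y a y 0 l) x =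
    \sum_m c a b m * Y m x 0 l + 0.
  by move=> /UM Mx; rewrite addr0; exact: bracketY.
have E0 x i j : \sum_a \sum_b g i a x * g j b x * 0 = 0.
  by rewrite big1// => a _; rewrite big1// => b _; rewrite mulr0.
(* The row of these coefficients is annihilated by the matrix [G x] (this is [hY]), and
   multiplication by the inverse [g] shows that it vanishes. *)
have h0 x i j m : U x -> new_constant Y g c x i j m = 0.
  move=> Ux.
  have hY l : \sum_m new_constant Y g c x i j m * Y m x 0 (f l) = 0.
    have := frame_change (fun i a => dg x i a Ux) i j
      (fun a => dY x a (f l) Ux) (fun a b => bracketY0 x (f l) a b Ux).
    (* The function is the coordinate [f l] of [X i'], which is constant on the open set [U]. *)
    have D0 i' v : 'D_v (fun y => \sum_b g i' b y * Y b y 0 (f l)) x = 0.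
      rewrite (@near_eq_derive _ _ _ _ (cst ((i' == l)%:R : R))) ?derive_cst//.
      have nU : nbhs x U by exact: open_nbhs_nbhs.
      by apply: (@filterS _ (nbhs x) (@nbhs_filter _ x) _ _ _ nU) => y Uy;
         rewrite -XE Xf.
    by rewrite !D0 subr0 E0 addr0.
  transitivity (\sum_l (\sum_m' new_constant Y g c x i j m' * Y m' x 0 (f l))
      * g l m x); last by apply: big1 => l _; rewrite hY mul0r.
  under eq_bigr do rewrite mulr_suml.
  rewrite exchange_big /= (bigD1 m)//= [X in _ + X]big1 ?addr0.
    under eq_bigr do rewrite -mulrA.
    by rewrite -mulr_sumr Yg// eqxx mulr1.
  move=> m' m'm; under eq_bigr do rewrite -mulrA.
  by rewrite -mulr_sumr Yg// (negbTE m'm) mulr0.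
exists f, U, g; split; split => //.
- move=> x i j l Ux; apply/eqP; rewrite -subr_eq0; apply/eqP.
  have -> : (fun y => new_frame Y g j y 0 l) =
      (fun y => \sum_b g j b y * Y b y 0 l) by apply/funext => y; rewrite -XE.
  have -> : (fun y => new_frame Y g i y 0 l) =
      (fun y => \sum_b g i b y * Y b y 0 l) by apply/funext => y; rewrite -XE.
  rewrite (frame_change (fun i a => dg x i a Ux) i j (fun a => dY x a l Ux)
    (fun a b => bracketY0 x l a b Ux)).
  by rewrite E0 addr0 big1// => m _; rewrite h0// mul0r.
- move=> x i j a b Ux.
  have -> : (fun y => comb_A g j y a b) =
      (fun y => \sum_m g j m y * A m y a b) by apply/funext => y; rewrite -AE.
  have -> : (fun y => comb_A g i y a b) =
      (fun y => \sum_m g i m y * A m y a b) by apply/funext => y; rewrite -AE.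
  rewrite (frame_change (fun i a => dg x i a Ux) i j (fun m => dA x m a b Ux)
    (fun m q => bracketA (UM _ Ux) m q a b)).
  rewrite big1 ?add0r => [|m _]; last by rewrite h0// mul0r.
  have mulE i' j' : comb_A g i' x *m comb_A g j' x =
      \sum_m \sum_q (g i' m x * g j' q x) *: (A m x *m A q x).
    rewrite /comb_A mulmx_suml; apply: eq_bigr => m _.
    rewrite mulmx_sumr; apply: eq_bigr => q _.
    by rewrite -scalemxAl -scalemxAr scalerA.
  rewrite !mulE [X in _ - X]exchange_big /= -sumrB summxE.
  apply: eq_bigr => m _; rewrite -sumrB summxE; apply: eq_bigr => q _.
  by rewrite [g j q x * _]mulrC -scalerBr [RHS]mxE.
Qed.

End FlatFrame.

(** * Transport along a commuting frame *)

Section IsDeriveRules.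
Context {R : realType} {V : normedModType R}.
Implicit Types (f g : V -> R) (x v : V).

Lemma is_derive_mul f g x v a b : is_derive x v f a -> is_derive x v g b ->
  is_derive x v (fun y => f y * g y) (f x * b + g x * a).
Proof. exact: is_deriveM. Qed.

Lemma is_derive_bigsum k (F : 'I_k -> V -> R) x v (d : 'I_k -> R) :
  (forall i, is_derive x v (F i) (d i)) ->
  is_derive x v (fun y => \sum_i F i y) (\sum_i d i).
Proof.
move=> dF; have := is_derive_sum dF.
suff -> : \sum_i F i = (fun y => \sum_i F i y) by [].
by apply/funext => y; rewrite fct_sumE.
Qed.

Lemma is_derive_sub f g x v a b : is_derive x v f a -> is_derive x v g b ->
  is_derive x v (fun y => f y - g y) (a - b).
Proof. exact: is_deriveB. Qed.

Lemma is_derive_mulr f x v a (r : R) : is_derive x v f a ->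
  is_derive x v (fun y => f y * r) (a * r).
Proof.
move=> df; have := is_derive_mul df (is_derive_cst r x v).
by rewrite mulr0 add0r mulrC.
Qed.

End IsDeriveRules.

Lemma derive_scale_dir (R : realType) n (h : 'rV[R]_n -> R) (x v : 'rV[R]_n)
    (a : R) : differentiable h x -> 'D_(a *: v) h x = a * 'D_v h x.
Proof. by move=> dh; rewrite !deriveE// linearZ. Qed.

Section State.
Context {R : realType} {n k p : nat}.
Local Notation N := (n + (k + p * p))%N.
Implicit Types (z w : 'rV[R]_N).

(** The results on flows are about row vectors, so the triple is packed into a single row, with [W]
    flattened by [mxvec]. *)
Definition state_mk (x : 'rV[R]_n) (s : 'rV[R]_k) (W : 'M[R]_p) : 'rV[R]_N :=
  row_mx x (row_mx s (mxvec W)).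
Definition idx_x (l : 'I_n) : 'I_N := lshift _ l.
Definition idx_s (j : 'I_k) : 'I_N := rshift n (lshift _ j).
Definition idx_W (a b : 'I_p) : 'I_N := rshift n (rshift k (mxvec_index a b)).
Definition state_x z : 'rV[R]_n := \row_l z 0 (idx_x l).
Definition state_W z : 'M[R]_p := \matrix_(a, b) z 0 (idx_W a b).

Lemma state_mk_x x s W l : state_mk x s W 0 (idx_x l) = x 0 l.
Proof. by rewrite /state_mk row_mxEl. Qed.

Lemma state_mk_s x s W j : state_mk x s W 0 (idx_s j) = s 0 j.
Proof. by rewrite /state_mk row_mxEr row_mxEl. Qed.

Lemma state_mk_W x s W a b : state_mk x s W 0 (idx_W a b) = W a b.
Proof. by rewrite /state_mk 2!row_mxEr mxvecE. Qed.

Lemma state_x_mk x s W : state_x (state_mk x s W) = x.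
Proof. by apply/rowP => l; rewrite mxE state_mk_x. Qed.

Lemma state_W_mk x s W : state_W (state_mk x s W) = W.
Proof. by apply/matrixP => a b; rewrite mxE state_mk_W. Qed.

Lemma state_ind (P : 'I_N -> Prop) : (forall l, P (idx_x l)) ->
  (forall j, P (idx_s j)) -> (forall a b, P (idx_W a b)) -> forall q, P q.
Proof.
move=> Px Ps PW q; rewrite -(splitK q); case: (fintype.split q) => [l|r] /=.
  exact: Px.
rewrite -(splitK r); case: (fintype.split r) => [j|u] /=; first exact: Ps.
by case/mxvec_indexP: u => a b; exact: PW.
Qed.

Lemma state_x_continuous : continuous state_x.
Proof.
move=> z; apply: rV_continuous => l.
have -> : (fun y => state_x y 0 l) = (fun y => y 0 (idx_x l)).
  by apply/funext => y; rewrite mxE.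
exact: coord_continuous.
Qed.

Lemma is_derive_state_x (h : 'rV[R]_n -> R) z w : differentiable h (state_x z) ->
  is_derive z w (fun y => h (state_x y)) ('D_(state_x w) h (state_x z)).
Proof.
move=> dh.
have E l : (fun y => state_x y 0 l) = (fun y => y 0 (idx_x l)).
  by apply/funext => y; rewrite mxE.
have dx l : differentiable (fun y => state_x y 0 l) z.
  by rewrite E; exact: differentiable_coord.
split; first by apply: diff_derivable; exact: differentiable_comp_rV.
rewrite (derive_comp_rV w dh dx) derive_sum_partial//.
apply: eq_bigr => l _; congr (_ * _); rewrite E mxE.
by have [_ ->] := is_derive_coord z w (idx_x l).
Qed.

End State.

Section Transport.
Context {R : realType} {n k p : nat}.
Local Notation N := (n + (k + p * p))%N.
Variables (U : set 'rV[R]_n) (X : 'I_k -> 'rV[R]_n -> 'rV[R]_n).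
Variables (A : 'I_k -> 'rV[R]_n -> 'M[R]_p) (f : 'I_k -> 'I_n) (x0 : 'rV[R]_n).
Hypotheses (oU : open U) (Ux0 : U x0).
Hypothesis sX : forall i l, smooth U (fun x => X i x 0 l).
Hypothesis sA : forall i a b, smooth U (fun x => A i x a b).
Hypothesis Xf : forall x i j, U x -> X i x 0 (f j) = (i == j)%:R.
Hypothesis commX : forall x i j l, U x ->
  'D_(X i x) (fun y => X j y 0 l) x = 'D_(X j x) (fun y => X i y 0 l) x.
Hypothesis flatA : forall x i j a b, U x ->
  'D_(X i x) (fun y => A j y a b) x - 'D_(X j x) (fun y => A i y a b) x
  = (A i x *m A j x - A j x *m A i x) a b.

(** With zero velocity for [s], dependence on this parameter becomes dependence on the initial
    condition. Both [Fx] and [FW] are linear in [s], so [F] vanishes wherever [s = 0]. *)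
Let Fx l (z : 'rV[R]_N) : R := \sum_j z 0 (idx_s j) * X j (state_x z) 0 l.
Let FW a b (z : 'rV[R]_N) : R :=
  \sum_j \sum_e z 0 (idx_s j) * A j (state_x z) a e * z 0 (idx_W e b).
Let F (z : 'rV[R]_N) : 'rV[R]_N :=
  state_mk (\row_l Fx l z) 0 (\matrix_(a, b) FW a b z).

Let Omega : set 'rV[R]_N := [set z | U (state_x z)].

Let oO : open Omega.
Proof.
by apply: (@open_comp _ _ (@state_x R n k p)) => // z _; exact: state_x_continuous.
Qed.

Let dX i l x : U x -> differentiable (fun y => X i y 0 l) x.
Proof. by move=> Ux; exact: (Cr_differentiable oU (sX i l 1%N) Ux). Qed.

Let dA i a b x : U x -> differentiable (fun y => A i y a b) x.
Proof. by move=> Ux; exact: (Cr_differentiable oU (sA i a b 1%N) Ux). Qed.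

Let sF q : smooth Omega (fun z => F z 0 q).
Proof.
move=> r.
have Cx l : Cr r Omega (fun z : 'rV[R]_N => state_x z 0 l).
  by apply: Cr_eq_on (Cr_coord r _ (idx_x l)) => // z _; rewrite mxE.
move: q; apply: (@state_ind n k p) => [l|j|a b].
- apply: (Cr_eq_on (f := Fx l)) => // [z _|]; first by rewrite state_mk_x mxE.
  apply: Cr_sum => // j _; apply: CrM => //; first exact: Cr_coord.
  exact: (Cr_comp oU oO (fun z H => H) (sX j l r) Cx).
- by apply: Cr_eq_on (Cr_cst r _ 0) => // z _; rewrite state_mk_s mxE.
- apply: (Cr_eq_on (f := FW a b)) => // [z _|]; first by rewrite state_mk_W mxE.
  apply: Cr_sum => // j _; apply: Cr_sum => // e _; apply: CrM => //.
    apply: CrM => //; first exact: Cr_coord.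
    exact: (Cr_comp oU oO (fun z H => H) (sA j a e r) Cx).
  exact: Cr_coord.
Qed.

Let linF z w q d : Omega z -> is_derive z w (fun z => F z 0 q) d ->
  linearized F z w 0 q = d.
Proof.
move=> Oz [_ <-]; rewrite mxE derive_sum_partial//.
exact: (Cr_differentiable oO (sF q 1%N) Oz).
Qed.

Let linFx z w l : Omega z -> linearized F z w 0 (idx_x l) =
  \sum_j (z 0 (idx_s j) * 'D_(state_x w) (fun y => X j y 0 l) (state_x z)
        + X j (state_x z) 0 l * w 0 (idx_s j)).
Proof.
move=> Oz; apply: linF => //.
have -> : (fun z => F z 0 (idx_x l)) = Fx l.
  by apply/funext => y; rewrite state_mk_x mxE.
apply: is_derive_bigsum => j; apply: is_derive_mul; first exact: is_derive_coord.
by apply: is_derive_state_x; exact: dX.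
Qed.

Let linFs z w j : Omega z -> linearized F z w 0 (idx_s j) = 0.
Proof.
move=> Oz; apply: linF => //.
have -> : (fun z => F z 0 (idx_s j)) = cst 0.
  by apply/funext => y; rewrite state_mk_s mxE.
exact: is_derive_cst.
Qed.

Let linFW z w a b : Omega z -> linearized F z w 0 (idx_W a b) =
  \sum_j \sum_e (z 0 (idx_s j) * A j (state_x z) a e * w 0 (idx_W e b)
   + z 0 (idx_W e b) * (z 0 (idx_s j) *
       'D_(state_x w) (fun y => A j y a e) (state_x z)
     + A j (state_x z) a e * w 0 (idx_s j))).
Proof.
move=> Oz; apply: linF => //.
have -> : (fun z => F z 0 (idx_W a b)) = FW a b.
  by apply/funext => y; rewrite state_mk_W mxE.
apply: is_derive_bigsum => j; apply: is_derive_bigsum => e.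
apply: is_derive_mul; last exact: is_derive_coord.
apply: is_derive_mul; first exact: is_derive_coord.
by apply: is_derive_state_x; exact: dA.
Qed.


Let z0 : 'rV[R]_N := state_mk x0 0 1%:M.
Let init (x : 'rV[R]_n) : 'rV[R]_N :=
  state_mk x (\row_j (x0 0 (f j) - x 0 (f j))) 1%:M.

Let Oz0 : Omega z0.
Proof. by rewrite /Omega /= state_x_mk. Qed.

Let F0 : F z0 = 0.
Proof.
apply/rowP; apply: (@state_ind n k p) => [l|j|a b]; rewrite [RHS]mxE.
- by rewrite state_mk_x mxE /Fx big1// => j _; rewrite state_mk_s mxE mul0r.
- by rewrite state_mk_s mxE.
- rewrite state_mk_W mxE /FW big1// => j _; rewrite big1// => e _.
  by rewrite state_mk_s mxE !mul0r.
Qed.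

Let init_x0 : init x0 = z0.
Proof.
by congr state_mk; apply/rowP => j; rewrite !mxE subrr.
Qed.

Let Cr_init r q : Cr r setT (fun x => init x 0 q).
Proof.
move: q; apply: (@state_ind n k p) => [l|j|a b].
- apply: Cr_eq_on (Cr_coord r _ l); first exact: openT.
  by move=> x _; rewrite state_mk_x.
- apply: Cr_eq_on (CrD openT (Cr_cst r _ (x0 0 (f j)))
    (CrM openT (Cr_cst r _ (-1)) (Cr_coord r _ (f j)))); first exact: openT.
  by move=> x _; rewrite state_mk_s mxE mulN1r.
- apply: Cr_eq_on (Cr_cst r _ ((1%:M : 'M[R]_p) a b)); first exact: openT.
  by move=> x _; rewrite state_mk_W.
Qed.

(** The normalisation [Xf] enters here: along [X i] only the coordinate [f i] among the chosen ones
    moves, at unit speed, whence the component [- delta_mx 0 i]. *)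
Let init_derive x i q : U x -> 'D_(X i x) (fun y => init y 0 q) x =
  state_mk (X i x) (- delta_mx 0 i) (0 : 'M[R]_p) 0 q.
Proof.
move=> Ux; move: q; apply: (@state_ind n k p) => [l|j|a b].
- rewrite state_mk_x; have -> : (fun y => init y 0 (idx_x l)) = (fun y => y 0 l).
    by apply/funext => y; rewrite state_mk_x.
  by have [_ ->] := is_derive_coord x (X i x) l.
- rewrite state_mk_s.
  have -> : (fun y => init y 0 (idx_s j)) =
      (fun y => cst (x0 0 (f j)) y - y 0 (f j)).
    by apply/funext => y; rewrite state_mk_s mxE.
  have [_ ->] := is_derive_sub (is_derive_cst (x0 0 (f j)) x (X i x))
    (is_derive_coord x (X i x) (f j)).
  by rewrite sub0r Xf// !mxE eqxx /= eq_sym.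
- rewrite state_mk_W mxE.
  have -> : (fun y => init y 0 (idx_W a b)) = cst ((1%:M : 'M[R]_p) a b).
    by apply/funext => y; rewrite state_mk_W.
  exact: derive_cst.
Qed.

Section Curve.
Variables (phi : R -> 'rV[R]_N -> 'rV[R]_N) (x : 'rV[R]_n) (z : 'rV[R]_N).
Hypothesis zE : z = init x.
Hypothesis solz : is_sol (fun=> F) z (phi^~ z).
Hypothesis Oz : forall t, Omega (phi t z).

Let gam t := state_x (phi t z).
Let W t := state_W (phi t z).
Let s t j := phi t z 0 (idx_s j).

Let d_idx (t : R) q : 0 < t < 1 ->
  is_derive t 1 (fun r => phi r z 0 q) (F (phi t z) 0 q).
Proof. by move=> t01; have [_ _ _ dz] := solz; exact: dz. Qed.

Let cphi q (t : R) : {for t, continuous (fun r => phi r z 0 q)}.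
Proof. by have [cz _ _ _] := solz; exact: continuous_coord (cz t). Qed.

Let cgam (t : R) : {for t, continuous gam}.
Proof.
apply: rV_continuous => l.
have -> : (fun r => gam r 0 l) = (fun r => phi r z 0 (idx_x l)).
  by apply/funext => r; rewrite mxE.
exact: cphi.
Qed.

Let d_gam (h : 'rV[R]_n -> R) (t : R) : 0 < t < 1 -> differentiable h (gam t) ->
  is_derive t 1 (fun r => h (gam r)) (\sum_j s t j * 'D_(X j (gam t)) h (gam t)).
Proof.
move=> t01 dh.
have E l : (fun r => gam r 0 l) = (fun r => phi r z 0 (idx_x l)).
  by apply/funext => r; rewrite mxE.
have dg l : is_derive t 1 (fun r => gam r 0 l) (F (phi t z) 0 (idx_x l)).
  by rewrite E; exact: d_idx.
have dg' l : differentiable (fun r => gam r 0 l) t.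
  by apply/derivable1_diffP; have [] := dg l.
split; first by apply: diff_derivable; exact: differentiable_comp_rV.
rewrite (derive_comp_rV (1 : R) dh dg') -derive_sum_dir// derive_sum_partial//.
apply: eq_bigr => l _; congr (_ * _); have [_ ->] := dg l.
rewrite state_mk_x mxE /Fx summxE; apply: eq_bigr => j _.
by rewrite [RHS]mxE.
Qed.

(** The curve satisfies [W' = S W] with [S] skew-symmetric, so the derivative [W^T S W + (S W)^T W]
    of [W^T W] is zero. *)
Lemma curve_orthogonal : (forall i x, U x -> skew_symmetric (A i x)) ->
  forall t : R, 0 <= t <= 1 -> (W t)^T *m W t = 1%:M.
Proof.
move=> skA t t01; apply/matrixP => a b.
pose q (r : R) : R := \sum_e phi r z 0 (idx_W e a) * phi r z 0 (idx_W e b).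
have qE r : ((W r)^T *m W r) a b = q r.
  by rewrite mxE; apply: eq_bigr => e _; rewrite !mxE.
have cq : continuous q.
  move=> r; apply: continuous_bigsum => e.
  have c1 : {for r, continuous (fun r => phi r z 0 (idx_W e a))} by exact: cphi.
  have c2 : {for r, continuous (fun r => phi r z 0 (idx_W e b))} by exact: cphi.
  exact: (continuousM c1 c2).
have dq (r : R) : 0 < r < 1 -> is_derive r 1 q 0.
  move=> r01; pose S : 'M[R]_p := \sum_j s r j *: A j (gam r).
  have skS : S^T = - S.
    rewrite /S linear_sum -sumrN; apply: eq_bigr => j _.
    by rewrite linearZ /= (skA j _ (Oz r)) scalerN.
  have FWE e' b' : F (phi r z) 0 (idx_W e' b') = (S *m W r) e' b'.
    rewrite state_mk_W mxE /FW exchange_big /= [RHS]mxE; apply: eq_bigr => e _.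
    by rewrite /S summxE mulr_suml; apply: eq_bigr => j _; rewrite !mxE.
  suff <- : \sum_e (phi r z 0 (idx_W e a) * F (phi r z) 0 (idx_W e b) +
      phi r z 0 (idx_W e b) * F (phi r z) 0 (idx_W e a)) = 0.
    by apply: is_derive_bigsum => e; apply: is_derive_mul; exact: d_idx.
  transitivity (((W r)^T *m (S *m W r) + (S *m W r)^T *m W r) a b).
    rewrite mxE [X in X + _]mxE [X in _ + X]mxE -big_split /=.
    apply: eq_bigr => e _; rewrite !FWE.
    have WE b' : phi r z 0 (idx_W e b') = W r e b' by rewrite mxE.
    rewrite !WE [trmx (W r) a e]mxE [trmx (S *m W r) a e]mxE.
    by congr (_ + _); exact: mulrC.
  by rewrite trmx_mul skS mulmxN mulNmx mulmxA subrr mxE.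
have d0 (r : R) : 0 < r < 1 -> is_derive r 1 (cst 0 : R -> R) 0.
  by move=> _; exact: is_derive_cst.
have le0 (r : R) : 0 < r < 1 -> `|0 : R| <= 0 by rewrite normr0.
have := derive_abs_le cq (@cst_continuous _ _ 0) dq d0 le0 t01.
rewrite subrr normr_le0 subr_eq0 qE => /eqP ->.
rewrite -qE; have [_ z_0 _ _] := solz.
by rewrite /W z_0 zE state_W_mk trmx1 mul1mx.
Qed.

(* The variation of the curve of initial point [x] in the direction [X i x]. *)
Let cand i (r : R) : 'rV[R]_N :=
  state_mk ((1 - r) *: X i (gam r)) (- delta_mx 0 i)
    ((1 - r) *: (A i (gam r) *m W r) - W r *m A i x).

Let cand_W i r a b : cand i r 0 (idx_W a b) =
  (1 - r) * (\sum_e A i (gam r) a e * phi r z 0 (idx_W e b))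
  - \sum_e phi r z 0 (idx_W a e) * A i x e b.
Proof.
rewrite state_mk_W mxE [X in X + _]mxE [X in _ + X]mxE; congr (_ * _ - _).
  by rewrite mxE; apply: eq_bigr => e _; rewrite !mxE.
by rewrite mxE; apply: eq_bigr => e _; rewrite !mxE.
Qed.

Let cand_x i r l : cand i r 0 (idx_x l) = (1 - r) * X i (gam r) 0 l.
Proof. by rewrite state_mk_x mxE. Qed.

Let c1r (r : R) : {for r, continuous (fun r : R => 1 - r)}.
Proof.
have c1 : {for r, continuous (cst 1 : R -> R)} by exact: cst_continuous.
have c2 : {for r, continuous (id : R -> R)} by exact: cvg_id.
exact: (continuousB c1 c2).
Qed.

Let cand_continuous i : continuous (cand i).
Proof.
move=> r; apply: rV_continuous; apply: (@state_ind n k p) => [l|j|a b].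
- have -> : (fun r => cand i r 0 (idx_x l)) =
      (fun r => (1 - r) * X i (gam r) 0 l).
    by apply/funext => q; rewrite cand_x.
  have cX := continuous_comp (cgam (t := r))
    (Cr_continuous (sX i l 0) (Oz r)).
  exact: (continuousM (c1r (r := r)) cX).
- have -> : (fun r => cand i r 0 (idx_s j)) =
      cst ((- delta_mx 0 i : 'rV[R]_k) 0 j).
    by apply/funext => q; rewrite state_mk_s.
  exact: cst_continuous.
- have -> : (fun r => cand i r 0 (idx_W a b)) = (fun r => (1 - r) *
      (\sum_e A i (gam r) a e * phi r z 0 (idx_W e b))
      - \sum_e phi r z 0 (idx_W a e) * A i x e b).
    by apply/funext => q; rewrite cand_W.
  have c2 : {for r, continuous (fun r => \sum_e A i (gam r) a e *
      phi r z 0 (idx_W e b))}.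
    apply: continuous_bigsum => e.
    have cA := continuous_comp (cgam (t := r))
      (Cr_continuous (sA i a e 0) (Oz r)).
    have cW : {for r, continuous (fun r => phi r z 0 (idx_W e b))} by exact: cphi.
    exact: (continuousM cA cW).
  have c3 : {for r, continuous (fun r => \sum_e phi r z 0 (idx_W a e)
      * A i x e b)}.
    apply: continuous_bigsum => e.
    have cW : {for r, continuous (fun r => phi r z 0 (idx_W a e))} by exact: cphi.
    have cA : {for r, continuous (cst (A i x e b) : R -> R)}.
      exact: cst_continuous.
    exact: (continuousM cW cA).
  exact: (continuousB (continuousM (c1r (r := r)) c2) c3).
Qed.

Let d1r (r : R) : is_derive r (1 : R) (fun r : R => 1 - r) (- 1).
Proof.
rewrite -[- 1]sub0r.
exact: (is_derive_sub (is_derive_cst (1 : R) r 1) (is_derive_id r (1 : R))).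
Qed.

(** Differentiating [(1 - t) X_i(gamma)] gives derivatives of [X_i] along the [X_j], where the
    linearised equation has those of [X_j] along [X_i]; [commX] exchanges them. The derivative of
    [1 - t] matches the component [- e_i] in [s]. *)
Let cand_derive_x i (t : R) l : 0 < t < 1 -> is_derive t 1
  (fun r => cand i r 0 (idx_x l)) (linearized F (phi t z) (cand i t) 0 (idx_x l)).
Proof.
move=> t01; have -> : (fun r => cand i r 0 (idx_x l)) =
    (fun r => (1 - r) * X i (gam r) 0 l).
  by apply/funext => q; rewrite cand_x.
apply: (is_derive_eq (is_derive_mul (d1r t) (d_gam t01 (dX i l (Oz t))))).
rewrite linFx// state_x_mk big_split /= -/(gam t) mulrN1; congr (_ + _).
  rewrite mulr_sumr; apply: eq_bigr => j _; rewrite mulrCA; congr (_ * _).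
  rewrite derive_scale_dir; last exact: dX (Oz t).
  by congr (_ * _); exact/esym/commX/Oz.
rewrite (bigD1 i)//= big1 ?addr0 => [|j ji].
  by rewrite /cand state_mk_s !mxE !eqxx mulrN1.
by rewrite /cand state_mk_s !mxE eqxx (negbTE ji) oppr0 mulr0.
Qed.

(** Both sides are written with the matrices [S], [D1], [D2] and [W]; they differ by
    [(1 - t) (D1 + A_i S - D2 - S A_i) W], which vanishes by flatness. *)
Let cand_derive_W i (t : R) a b : 0 < t < 1 -> is_derive t 1
  (fun r => cand i r 0 (idx_W a b))
  (linearized F (phi t z) (cand i t) 0 (idx_W a b)).
Proof.
move=> t01; have -> : (fun r => cand i r 0 (idx_W a b)) = (fun r => (1 - r) *
    (\sum_e A i (gam r) a e * phi r z 0 (idx_W e b))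
    - \sum_e phi r z 0 (idx_W a e) * A i x e b).
  by apply/funext => q; rewrite cand_W.
pose S : 'M[R]_p := \sum_j s t j *: A j (gam t).
have FWE e' b' : F (phi t z) 0 (idx_W e' b') = (S *m W t) e' b'.
  rewrite state_mk_W mxE /FW exchange_big /= [RHS]mxE; apply: eq_bigr => e _.
  by rewrite /S summxE mulr_suml; apply: eq_bigr => j _; rewrite !mxE.
have WE e' b' : phi t z 0 (idx_W e' b') = W t e' b' by rewrite mxE.
pose DA i' j : 'M[R]_p :=
  \matrix_(a', b') 'D_(X j (gam t)) (fun y => A i' y a' b') (gam t).
have dAi e := d_gam t01 (dA i a e (Oz t)).
have d1 := is_derive_bigsum
  (fun e => is_derive_mul (dAi e) (d_idx (idx_W e b) t01)).
have d2 := is_derive_bigsum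
  (fun e => is_derive_mulr (A i x e b) (d_idx (idx_W a e) t01)).
apply: (is_derive_eq (is_derive_sub (is_derive_mul (d1r t) d1) d2)).
pose Ai := A i (gam t).
(* [D1] is the derivative of [A_i] along the curve, which occurs in the candidate; [D2] contracts
   with [s] the derivatives of the [A_j] along [X_i], which occur in the linearised equation. [DE]
   below is flatness contracted with [s]. *)
pose D1 : 'M[R]_p := \sum_j s t j *: DA i j.
pose D2 : 'M[R]_p := \sum_j s t j *: DA j i.
pose Wc : 'M[R]_p := (1 - t) *: (Ai *m W t) - W t *m A i x.
have E1 : \sum_e (Ai a e * F (phi t z) 0 (idx_W e b) + phi t z 0 (idx_W e b) *
      \sum_j s t j * 'D_(X j (gam t)) (fun y => A i y a e) (gam t)) =
    (Ai *m S *m W t) a b + (D1 *m W t) a b.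
  rewrite big_split /= -mulmxA [X in _ = X + _]mxE [X in _ = _ + X]mxE.
  congr (_ + _); apply: eq_bigr => e _; first by rewrite FWE.
  rewrite WE mulrC /D1 summxE; congr (_ * _); apply: eq_bigr => j _.
  by rewrite !mxE.
have E2 : \sum_e Ai a e * phi t z 0 (idx_W e b) = (Ai *m W t) a b.
  by rewrite mxE; apply: eq_bigr => e _; rewrite WE.
have E3 : \sum_e F (phi t z) 0 (idx_W a e) * A i x e b =
    (S *m W t *m A i x) a b.
  by rewrite [RHS]mxE; apply: eq_bigr => e _; rewrite FWE.
have DE : D1 = D2 - (Ai *m S - S *m Ai).
  rewrite /D1 /D2 /S mulmx_sumr mulmx_suml -!sumrB; apply: eq_bigr => j _.
  rewrite -scalemxAr -scalemxAl -!scalerBr; congr (_ *: _).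
  apply/matrixP => a' b'; rewrite [RHS]mxE [X in _ + X]mxE.
  have -> : (Ai *m A j (gam t) - A j (gam t) *m Ai) a' b' =
      DA j i a' b' - DA i j a' b'.
    by rewrite -flatA; [rewrite !mxE|exact: Oz].
  by ring.
rewrite E1 E2 E3 linFW// /cand state_x_mk -/(gam t).
(* The linearised equation in matrix form: its three terms come from the variations of [W], of [x]
   and of [s]. *)
transitivity ((S *m Wc) a b + (1 - t) * (D2 *m W t) a b - (Ai *m W t) a b).
  have -> : (S *m Wc) a b = (1 - t) * (S *m Ai *m W t) a b
      - (S *m W t *m A i x) a b.
    by rewrite /Wc mulmxBr -scalemxAr !mulmxA mxE [X in X + _]mxE
      [X in _ + X]mxE.
  have -> : (D1 *m W t) a b =
      (D2 *m W t) a b - (Ai *m S *m W t) a b + (S *m Ai *m W t) a b.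
    rewrite DE !mulmxBl 3!mxE [X in _ - X = _]mxE [X in _ - (_ + X) = _]mxE.
    by ring.
  by ring.
have -> : (S *m Wc) a b =
    \sum_j \sum_e s t j * A j (gam t) a e * Wc e b.
  rewrite exchange_big /= mxE; apply: eq_bigr => e _.
  have -> : S a e = \sum_j s t j * A j (gam t) a e.
    by rewrite /S summxE; apply: eq_bigr => j _; rewrite mxE.
  by rewrite mulr_suml.
have -> : (1 - t) * (D2 *m W t) a b =
    \sum_j \sum_e W t e b * (s t j * ((1 - t) * DA j i a e)).
  rewrite exchange_big /= mxE mulr_sumr; apply: eq_bigr => e _.
  have -> : D2 a e = \sum_j s t j * DA j i a e.
    by rewrite /D2 summxE; apply: eq_bigr => j _; rewrite mxE.
  by rewrite mulr_suml mulr_sumr; apply: eq_bigr => j _; ring.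
have -> : (Ai *m W t) a b = - \sum_j \sum_e W t e b * (A j (gam t) a e *
    (- delta_mx 0 i : 'rV[R]_k) 0 j).
  rewrite (bigD1 i)//= [X in _ + X]big1 ?addr0 => [|j ji]; last first.
    by apply: big1 => e _; rewrite !mxE eqxx (negbTE ji) oppr0 !mulr0.
  rewrite mxE -sumrN; apply: eq_bigr => e _.
  have -> : (- delta_mx 0 i : 'rV[R]_k) 0 i = - 1 by rewrite !mxE !eqxx.
  by rewrite /Ai; ring.
rewrite opprK -!big_split /=; apply: eq_bigr => j _.
rewrite -!big_split /=; apply: eq_bigr => e _.
rewrite state_mk_W state_mk_s WE mulrDr addrA; congr (_ + _ * _ + _).
rewrite mxE derive_scale_dir//; exact: dA (Oz t).
Qed.

(** At time 0 one has [W = 1], so the two matrix terms of the candidate cancel and it starts at the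
    derivative of [init] along [X i]. *)
Lemma curve_derive i : is_sol (fun t w => linearized F (phi t z) w)
  (state_mk (X i x) (- delta_mx 0 i) 0) (cand i \o clamp01).
Proof.
apply: is_sol_clamp; first exact: cand_continuous.
  have [_ z_0 _ _] := solz; rewrite /cand /gam /W z_0 zE state_x_mk state_W_mk.
  by rewrite subr0 !scale1r mulmx1 mul1mx subrr.
move=> t t01; apply: (@state_ind n k p) => [l|j|a b].
- exact: cand_derive_x.
- rewrite linFs//.
  have -> : (fun r => cand i r 0 (idx_s j)) =
      cst ((- delta_mx 0 i : 'rV[R]_k) 0 j).
    by apply/funext => q; rewrite state_mk_s.
  exact: is_derive_cst.
- exact: cand_derive_W.
Qed.

Lemma cand_end i a b : cand i 1 0 (idx_W a b) = - (W 1 *m A i x) a b.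
Proof.
rewrite cand_W subrr mul0r sub0r; congr (- _); rewrite mxE.
by apply: eq_bigr => e _; rewrite mxE.
Qed.

End Curve.

Lemma transport : exists (U1 : set 'rV[R]_n) (B : 'rV[R]_n -> 'M[R]_p),
  [/\ open U1, U1 x0, U1 `<=` U & smoothmx U1 B] /\
  [/\ B x0 = 1%:M,
      forall x i a b, U1 x ->
        'D_(X i x) (fun y => B y a b) x = - (B x *m A i x) a b &
      (forall i x, U x -> skew_symmetric (A i x)) ->
        forall x, U1 x -> B x *m (B x)^T = 1%:M].
Proof.
have [rho [D [phi [r0 cO oD Dz0 [flowP phiz0]]]]] := local_flow oO Oz0 sF F0.
have cinit x : {for x, continuous init}.
  by apply: rV_continuous => q; exact: Cr_continuous (Cr_init 0 q) _.
pose U1 := [set x | U x /\ D (init x)].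
have oU1 : open U1 by apply: (open_preimage_in oU) => // x _; exact: cinit.
pose B x : 'M[R]_p := state_W (phi 1 (init x)).
have BE a b : (fun x => B x a b) = (fun z => phi 1 z 0 (idx_W a b)) \o init.
  by apply/funext => x; rewrite mxE.
have solx x (U1x : U1 x) := flowP _ (proj2 U1x).
have Ox x t : U1 x -> Omega (phi t (init x)).
  by move=> /solx[_ Q]; exact: cO.
exists U1, B; split; split.
- exact: oU1.
- by split=> //; rewrite init_x0.
- by move=> x [].
- move=> a b r; rewrite BE.
  apply: (Cr_comp oD oU1 (fun x H => proj2 H)) => [|q].
    exact: (flow_Cr r oO r0 cO sF oD flowP).
  exact: Cr_subset (Cr_init r q).
- by rewrite /B init_x0 phiz0 state_W_mk.
- move=> x i a b U1x; have [Ux Dx] := U1x; have [sol _] := solx x U1x.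
  have cs := curve_derive erefl sol (fun t => Ox x t U1x) i.
  have d := flow_derive oO r0 cO sF oD flowP Dx cs 1 (idx_W a b).
  have := cand_end phi x (init x) i a b.
  have c1 : clamp01 (1 : R) = 1 by rewrite clamp_id// lexx ler01.
  move: d; rewrite /= c1 => d e; rewrite e in d.
  rewrite BE.
  have dphi : differentiable (fun z => phi 1 z 0 (idx_W a b)) (init x).
    exact: (Cr_differentiable oD (flow_Cr 1 oO r0 cO sF oD flowP 1 _) Dx).
  have dinit q : differentiable (fun y => init y 0 q) x.
    exact: (Cr_differentiable openT (Cr_init 1 q)).
  (* By the chain rule, differentiating [B] along [X i] is differentiating the time-1 flow in the
     direction supplied by [init_derive], the very initial value of [curve_derive]. *)
  rewrite derive_comp_rV//.
  under eq_bigr do rewrite init_derive//.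
  rewrite -derive_sum_partial//; by have [_ ->] := d.
- move=> skA x U1x; have [Ux Dx] := U1x; have [sol _] := solx x U1x.
  apply: mulmx1C.
  apply: (curve_orthogonal erefl sol (fun t => Ox x t U1x) skA).
  by rewrite lexx ler01.
Qed.

End Transport.

(** * Integration of the flat system *)

Section FlatParallelFrame.
Context {R : realType} {n k p : nat}.
Variables (M : set 'rV[R]_n) (Y : 'I_k -> 'rV[R]_n -> 'rV[R]_n).
Variables (A : 'I_k -> 'rV[R]_n -> 'M[R]_p) (c : 'I_k -> 'I_k -> 'I_k -> R).
Variables (x0 : 'rV[R]_n).
Hypotheses (oM : open M) (Mx0 : M x0).
Hypothesis sY : forall i l, smooth M (fun x => Y i x 0 l).
Hypothesis sA : forall i a b, smooth M (fun x => A i x a b).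
Hypothesis freeY : row_free (\matrix_(i < k) Y i x0).
Hypothesis bracketY : forall x, M x -> forall i j l,
  vf_app (Y i) (fun y => Y j y 0 l) x - vf_app (Y j) (fun y => Y i y 0 l) x =
  \sum_m c i j m * Y m x 0 l.
Hypothesis bracketA : forall x, M x -> forall i j a b,
  vf_app (Y i) (fun y => A j y a b) x - vf_app (Y j) (fun y => A i y a b) x =
  \sum_m c i j m * A m x a b + (A i x *m A j x - A j x *m A i x) a b.

(** The equation is linear in the pair formed by a direction and its matrix. It holds for the pairs
    [(X_j, A'_j)] of the commuting frame, hence for their combinations [(Y_i, A_i)]. *)
Lemma flat_parallel_frame : exists (U : set 'rV[R]_n) (B : 'rV[R]_n -> 'M[R]_p),
  [/\ open U, U x0, U `<=` M & smoothmx U B] /\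
  [/\ B x0 = 1%:M,
      forall i x, U x -> vf_appmx (Y i) B x = - (B x *m A i x) &
      (forall i x, M x -> skew_symmetric (A i x)) ->
        forall x, U x -> B x *m (B x)^T = 1%:M].
Proof.
have dY i l x : M x -> differentiable (fun y => Y i y 0 l) x.
  by move=> Mx; exact: (Cr_differentiable oM (sY i l 1%N) Mx).
have dA i a b x : M x -> differentiable (fun y => A i y a b) x.
  by move=> Mx; exact: (Cr_differentiable oM (sA i a b 1%N) Mx).
have bracketY' x : M x -> forall i j l,
  'D_(Y i x) (fun y => Y j y 0 l) x - 'D_(Y j x) (fun y => Y i y 0 l) x =
  \sum_m c i j m * Y m x 0 l.
  move=> Mx i j l; rewrite -(vf_appE (Y i) (dY j l x Mx)).
  by rewrite -(vf_appE (Y j) (dY i l x Mx)) bracketY.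
have bracketA' x : M x -> forall i j a b,
  'D_(Y i x) (fun y => A j y a b) x - 'D_(Y j x) (fun y => A i y a b) x =
  \sum_m c i j m * A m x a b + (A i x *m A j x - A j x *m A i x) a b.
  move=> Mx i j a b; rewrite -(vf_appE (Y i) (dA j a b x Mx)).
  by rewrite -(vf_appE (Y j) (dA i a b x Mx)) bracketA.
have [f [U0 [g [[oU0 U0x0 U0M sg] [Xf Yg commX flatA]]]]] :=
  commuting_frame oM Mx0 sY sA freeY bracketY' bracketA'.
have sX i l : smooth U0 (fun x => new_frame Y g i x 0 l).
  move=> r; apply: (Cr_eq_on (f := fun x => \sum_b g i b x * Y b x 0 l)) => //.
    by move=> x _; rewrite summxE; apply: eq_bigr => b _; rewrite mxE.
  apply: Cr_sum => // b _; apply: CrM => //; first exact: sg.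
  exact: Cr_subset (sY b l r).
have sA' i a b : smooth U0 (fun x => comb_A A g i x a b).
  move=> r; apply: (Cr_eq_on (f := fun x => \sum_m g i m x * A m x a b)) => //.
    by move=> x _; rewrite summxE; apply: eq_bigr => m _; rewrite mxE.
  apply: Cr_sum => // m _; apply: CrM => //; first exact: sg.
  exact: Cr_subset (sA m a b r).
have [U [B [[oU Ux0 UU0 sB] [B0 dB orthB]]]] :=
  transport oU0 U0x0 sX sA' Xf commX flatA.
exists U, B; split; split => //.
- by move=> x /UU0 /U0M.
- move=> i x Ux; apply/matrixP => a b.
  have dBx : differentiable (fun y => B y a b) x.
    exact: (Cr_differentiable oU (sB a b 1%N) Ux).
  rewrite mxE vf_appE//.
  (* Undoing the change of frame takes the same coefficients for vectors and for matrices, so it is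
     stated in an arbitrary module. *)
  have frameK (W : lmodType R) (Z : 'I_k -> W) :
      Z i = \sum_j Y i x 0 (f j) *: \sum_m g j m x *: Z m.
    under eq_bigr do rewrite scaler_sumr.
    rewrite exchange_big /= (bigD1 i)//= [X in _ + X]big1 ?addr0 => [|m mi].
      under eq_bigr do rewrite scalerA.
      by rewrite -scaler_suml Yg ?eqxx ?scale1r//; exact: UU0.
    under eq_bigr do rewrite scalerA.
    rewrite -scaler_suml Yg; last exact: UU0.
    by rewrite eq_sym (negbTE mi) scale0r.
  have YE : Y i x = \sum_j Y i x 0 (f j) *: new_frame Y g j x.
    exact: (frameK _ (Y^~ x)).
  have AE : A i x = \sum_j Y i x 0 (f j) *: comb_A A g j x.
    exact: (frameK _ (A^~ x)).
  rewrite {1}YE derive_sum_dir// {1}AE mulmx_sumr [RHS]mxE summxE -sumrN.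
  apply: eq_bigr => j _; rewrite dB//.
  by rewrite -scalemxAr [in RHS]mxE mulrN.
- move=> skA; apply: orthB => i x U0x; rewrite /skew_symmetric /comb_A.
  rewrite linear_sum -sumrN; apply: eq_bigr => m _.
  by rewrite linearZ /= (skA m x (U0M _ U0x)) scalerN.
Qed.

End FlatParallelFrame.

(** * Triads over the identity and their push-forwards *)

Lemma smooth_eq_on (R : realType) n (U : set 'rV[R]_n) (f g : 'rV[R]_n -> R) :
  open U -> (forall x, U x -> f x = g x) -> smooth U f -> smooth U g.
Proof. by move=> oU fg sf r; apply: Cr_eq_on (sf r). Qed.

Lemma sum_triad (R : realType) n m k (c : 'I_k -> R)
    (Y : 'I_k -> 'rV[R]_n -> 'rV[R]_n) (C : 'I_k -> 'rV[R]_n -> 'M[R]_m)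
    (tau : 'I_k -> 'rV[R]_n -> R) :
  \sum_i c i *: ((Y i, C i, tau i) : inf_triad R n m) =
  ((fun x => \sum_i c i *: Y i x), (fun x => \sum_i c i *: C i x),
   (fun x => \sum_i c i * tau i x)).
Proof.
elim: (index_enum _) => [|i s IH].
  by rewrite big_nil; congr (_, _, _); apply/funext => x; rewrite big_nil.
rewrite big_cons IH.
by congr (_, _, _); apply/funext => x; rewrite big_cons.
Qed.

Lemma pinv_id (R : realType) n (U : set 'rV[R]_n) x : U x -> pinv U id x = x.
Proof.
have idI : {in U &, injective (id : 'rV[R]_n -> 'rV[R]_n)} by move=> ? ? _ _.
by move=> Ux; apply: (pinvKV _ idI); rewrite inE.
Qed.

Lemma jacobian_id (R : realType) n (v x : 'rV[R]_n) : v *m 'J id x = v.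
Proof.
rewrite /jacobian mul_rV_lin1.
by have [_ ->] := is_diff_id x.
Qed.

Theorem theorem3p3 (R : realType) (n m k : nat) (M : set 'rV[R]_n)
    (Y : 'I_k -> 'rV[R]_n -> 'rV[R]_n)
    (C : 'I_k -> 'rV[R]_n -> 'M[R]_m)
    (tau : 'I_k -> 'rV[R]_n -> R)
    (V := fun i => (Y i, C i, tau i) : inf_triad R n m)
    (x0 : 'rV[R]_n) :
  open M ->
  (forall i, inf_stoch_transf M (V i)) ->
  lie_subalgebra M (span_on M V) ->
  M x0 ->
  row_free (\matrix_(i < k) Y i x0) ->
  exists U : set 'rV[R]_n,
    [/\ open U, U x0, U `<=` M &
      exists (B : 'rV[R]_n -> 'M[R]_m) (eta : 'rV[R]_n -> R),
        [/\ stoch_transf U (id, B, eta),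
            (forall i, inf_stoch_transf U (pushforward U (id, B, eta) (V i)) /\
                       strong U (pushforward U (id, B, eta) (V i))) &
            (forall i x, U x ->
               vf_appmx (Y i) B x = - (B x *m C i x) /\
               vf_app (Y i) eta x = - (tau i x * eta x))]].
Proof.
move=> oM smV [_ _ _ lieV] Mx0 freeY.
have spanV i : span_on M V (V i).
  exists (fun l => (l == i)%:R).
  have -> : \sum_(l < k) (l == i)%:R *: V l = V i.
    rewrite (bigD1 i) //= eqxx big1 => [|l li]; first by rewrite scale1r addr0.
    by rewrite (negbTE li) scale0r.
  by move=> x _.
(* Closure is applied to pairs of generators; membership in the span is an equality of triads, so
   one family of coefficients serves all three components. *)
have /choice[c cP] : forall p : 'I_k * 'I_k, exists c : 'I_k -> R,
    eq_on M (bracket (V p.1) (V p.2)) (\sum_(l < k) c l *: V l).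
  by move=> [i j] /=; have [c cE] := lieV _ _ (spanV i) (spanV j); exists c.
have brk i j x : M x -> [/\ vf_bracket (Y i) (Y j) x = \sum_l c (i, j) l *: Y l x,
    vf_appmx (Y i) (C j) x - vf_appmx (Y j) (C i) x
      - (C i x *m C j x - C j x *m C i x) = \sum_l c (i, j) l *: C l x &
    vf_app (Y i) (tau j) x - vf_app (Y j) (tau i) x =
      \sum_l c (i, j) l * tau l x].
  by move=> Mx; have := cP (i, j); rewrite sum_triad => /(_ x Mx).
have sY i l : smooth M (fun x => Y i x 0 l) by have [sY _ _] := smV i; exact: sY.
have sC i a b : smooth M (fun x => C i x a b).
  by have [_ [sC _] _] := smV i; exact: sC.
have skC i x : M x -> skew_symmetric (C i x).
  by have [_ [_ skC] _] := smV i; exact: skC.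
have st i : smooth M (tau i) by have [_ _ st] := smV i.
pose T i x : 'M[R]_1 := \matrix_(a, b) tau i x.
have sT i a b : smooth M (fun x => T i x a b).
  by apply: smooth_eq_on (st i) => // x _; rewrite mxE.
have bY x : M x -> forall i j l,
    vf_app (Y i) (fun y => Y j y 0 l) x - vf_app (Y j) (fun y => Y i y 0 l) x =
    \sum_q c (i, j) q * Y q x 0 l.
  move=> Mx i j l; have [+ _ _] := brk i j x Mx.
  move/(congr1 (fun v : 'rV[R]_n => v 0 l)); rewrite !mxE => ->.
  by rewrite summxE; apply: eq_bigr => q _; rewrite mxE.
have bC x : M x -> forall i j a b,
    vf_app (Y i) (fun y => C j y a b) x - vf_app (Y j) (fun y => C i y a b) x =
    \sum_q c (i, j) q * C q x a b + (C i x *m C j x - C j x *m C i x) a b.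
  move=> Mx i j a b; have [_ + _] := brk i j x Mx.
  move/(canRL (subrK _))/matrixP/(_ a b); rewrite !mxE => ->.
  by rewrite summxE; congr (_ + _); apply: eq_bigr => q _; rewrite mxE.
have bT x : M x -> forall i j a b,
    vf_app (Y i) (fun y => T j y a b) x - vf_app (Y j) (fun y => T i y a b) x =
    \sum_q c (i, j) q * T q x a b + (T i x *m T j x - T j x *m T i x) a b.
  move=> Mx i j a b; have [_ _ +] := brk i j x Mx.
  have TE q : (fun y => T q y a b) = tau q by apply/funext => y; rewrite mxE.
  rewrite !TE => ->; rewrite !mxE !big_ord1 !mxE [X in X - _]mulrC subrr addr0.
  by apply: eq_bigr => q _; rewrite mxE.
have [U1 [B [[oU1 U1x0 U1M sB] [B0 dB orthB]]]] :=
  flat_parallel_frame oM Mx0 sY sC freeY bY bC.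
have [U2 [E [[oU2 U2x0 U2M sE] [E0 dE _]]]] :=
  flat_parallel_frame oM Mx0 sY sT freeY bY bT.
pose eta x := E x 0 0.
(* Orthogonality leaves [det B] equal to 1 or -1. Positivity is an open condition, true at [x0]
   where [B] is the identity, and it selects 1; [U4] does the same for the sign of [eta]. *)
pose U3 := [set x | U1 x /\ [set r : R | 0 < r] (\det (B x))].
pose U4 := [set x | U2 x /\ [set r : R | 0 < r] (eta x)].
have oU3 : open U3.
  have cd x : U1 x -> {for x, continuous (fun x => \det (B x))}.
    exact: Cr_continuous (Cr_det oU1 (fun a b => sB a b 0%N)).
  exact: (open_preimage_in oU1 cd (@open_gt _ 0)).
have oU4 : open U4.
  have ce x : U2 x -> {for x, continuous eta}.
    exact: Cr_continuous (sE 0 0 0%N).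
  exact: (open_preimage_in oU2 ce (@open_gt _ 0)).
pose U := U3 `&` U4.
have oU : open U by exact: openI.
have UM : U `<=` M by move=> x [[/U1M]].
have UU1 x : U x -> U1 x by move=> [[]].
have UU2 x : U x -> U2 x by move=> [_ []].
have eta0 x : U x -> 0 < eta x by move=> [_ []].
have sBU : smoothmx U B by move=> a b r; apply: Cr_subset (sB a b r).
have seU : smooth U eta by move=> r; apply: Cr_subset (sE 0 0 r).
have sYU i l : smooth U (fun x => Y i x 0 l).
  by move=> r; apply: Cr_subset (sY i l r).
have eqB i x : U x -> vf_appmx (Y i) B x = - (B x *m C i x).
  by move=> /UU1; exact: dB.
have eqe i x : U x -> vf_app (Y i) eta x = - (tau i x * eta x).
  move=> /UU2 /(dE i x) /matrixP/(_ 0 0).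
  by rewrite !mxE big_ord1 mxE mulrC.
exists U; split => //.
  split; split => //=; first by rewrite B0 det1.
  by rewrite /eta E0 mxE eqxx.
exists B, eta; split => //.
- split=> //.
  + split.
    * split=> [x Ux|x y _ _|x Ux]; [exact: Ux|by []|by exists x].
    * move=> a b r; rewrite (ord1 a); exact: Cr_coord.
    * move=> a b r; rewrite (ord1 a).
      by apply: Cr_eq_on (Cr_coord r U b) => // x Ux; rewrite pinv_id.
  + split=> // x Ux; have BB := orthB skC x (UU1 x Ux).
    split=> //; have d0 : 0 < \det (B x) by case: Ux => -[].
    have := congr1 determinant BB; rewrite det_mulmx det_tr det1 => d1.
    have : (\det (B x) - 1) * (\det (B x) + 1) = 0.
      by rewrite -subr_sqr expr2 d1 expr1n subrr.
    move/eqP; rewrite mulf_eq0 subr_eq0 => /orP[/eqP//|].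
    by rewrite gt_eqF// addr_gt0.
- move=> i.
  (* The equation for [B] makes the two terms of the transformed matrix opposite, and [t0] does the
     same for the scalar: this is strongness. *)
  have C0 x : U x -> B x *m C i x *m invmx (B x)
      + vf_appmx (Y i) B x *m invmx (B x) = 0.
    by move=> Ux; rewrite eqB// mulNmx subrr.
  have t0 x : U x -> tau i x + vf_app (Y i) eta x * (eta x)^-1 = 0.
    by move=> Ux; rewrite eqe// mulNr mulfK ?subrr// gt_eqF// eta0.
  split; last by move=> x Ux; rewrite /= pinv_id// C0// t0.
  split.
  (* [pinv U id] is known to be the identity only on [U], so smoothness of each component is
     obtained from a simpler function agreeing with it there: [Y i], or zero. *)
  + move=> a l; rewrite (ord1 a); apply: smooth_eq_on (sYU i l) => // x Ux.
    by rewrite /= pinv_id// jacobian_id.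
  + split=> [a b|x Ux]; last first.
      by rewrite /= pinv_id// C0// /skew_symmetric trmx0 oppr0.
    apply: (@smooth_eq_on _ _ _ (fun=> 0)) => // [x Ux|r]; last exact: Cr_cst.
    by rewrite /= pinv_id// C0// mxE.
  + apply: (@smooth_eq_on _ _ _ (fun=> 0)) => // [x Ux|r]; last exact: Cr_cst.
    by rewrite /= pinv_id// t0.
- by move=> i x Ux; split; [exact: eqB|exact: eqe].
Qed.
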